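(* There is an absolute constant $c_1>0$ such that the following holds. Let $Q,N\in\mathbb{N}$ with $Q\ge16$, $N=Q^{1+\delta}/16$ and $0<\delta<1$, and let $(a_n)_{n\in\mathbb{Z}[i]}$ be any sequence of complex numbers. Then $$\sum_{\mathcal{N}(p)\le Q}\ \sum_{\substack{a\bmod p\\ (a,p)=1}}\Big|\sum_{\substack{n\in\mathbb{Z}[i]\\ \mathcal{N}(n)\le N}}a_n\, e\Big(\Re\Big(\frac{na}{p}\Big)\Big)\Big|^2\le\frac{c_1}{1-\delta}\cdot\frac{Q^2\log\log Q}{\log Q}\,Z,$$ where $p$ runs over the Gaussian primes with $\mathcal{N}(p)\le Q$ and $Z=\sum_{n\in\mathbb{Z}[i],\ \mathcal{N}(n)\le N}|a_n|^2$.
   Context: $e(x)=e^{2\pi i x}$. $\mathbb{Z}[i]$ denotes the Gaussian integers and $\mathcal{N}(q)=\Re(q)^2+\Im(q)^2$. ''$a\bmod p$, $(a,p)=1$'' means $a$ runs over a complete system of nonzero residues modulo $p$ in $\mathbb{Z}[i]$. *)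

(* Defs.v *)
From HB Require Import structures.
From mathcomp Require Import all_boot all_order all_algebra.
From mathcomp Require Import complex.
From mathcomp Require Import all_classical all_reals all_analysis.
Set Implicit Arguments. Unset Strict Implicit. Unset Printing Implicit Defensive.
Import Order.TTheory GRing.Theory Num.Theory.
Local Open Scope ring_scope.

(* Gaussian integers Z[i]: x + i y represented as the pair (x, y). *)
Definition gint := (int * int)%type.

Definition GI_gadd (u v : gint) : gint := (u.1 + v.1, u.2 + v.2).
Definition GI_gsub (u v : gint) : gint := (u.1 - v.1, u.2 - v.2).
Definition GI_gmul (u v : gint) : gint :=
  (u.1 * v.1 - u.2 * v.2, u.1 * v.2 + u.2 * v.1).
Definition GI_gzero : gint := (0, 0).
Definition GI_gone : gint := (1, 0).

Definition GI_gnorm (u : gint) : int := u.1 ^+ 2 + u.2 ^+ 2.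

Definition GI_gdvd (d n : gint) : Prop := exists k : gint, n = GI_gmul d k.
Definition GI_gcong (p a b : gint) : Prop := GI_gdvd p (GI_gsub a b).

Definition GI_gunit (u : gint) : Prop := GI_gdvd u GI_gone.

Definition GI_gprime (p : gint) : Prop :=
  p <> GI_gzero /\ ~ GI_gunit p /\
  forall a b : gint, GI_gdvd p (GI_gmul a b) -> GI_gdvd p a \/ GI_gdvd p b.

(* s is a complete system of nonzero residues modulo p
   (for p prime, these are exactly the classes a with (a, p) = 1). *)
Definition nonzero_residue_system (p : gint) (s : seq gint) : Prop :=
  (forall a, a \in s -> ~ GI_gcong p a GI_gzero) /\
  (forall i j, (i < size s)%N -> (j < size s)%N ->
     GI_gcong p (nth GI_gzero s i) (nth GI_gzero s j) -> i = j) /\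
  (forall b, ~ GI_gcong p b GI_gzero -> exists2 a, a \in s & GI_gcong p b a).

(* All Gaussian integers x + iy with |x|, |y| <= M (a finite enumeration
   containing every q with N(q) <= M). *)
Definition GI_zrange (M : nat) : seq int :=
  map (fun k : nat => k%:Z - M%:Z) (iota 0 (M.*2.+1)).
Definition GI_gbox (M : nat) : seq gint :=
  [seq (x, y) | x <- GI_zrange M, y <- GI_zrange M].

Section Analytic.
Variable R : realType.

Definition GI_gtoC (u : gint) : R[i] := Complex (u.1%:~R) (u.2%:~R).

Definition GI_e (x : R) : R[i] :=
  Complex (cos (2 * pi * x)) (sin (2 * pi * x)).

Definition GI_cabs (z : R[i]) : R := Normc.normc z.
End Analytic.

(* Main.v *)
(* A dual large sieve bounds the left-hand side by N times the largest number of fractions b/p lying in one square of side N^(-1/2) modulo Z[i]. To count these fractions near alpha, take a Dirichlet approximation b0/r of alpha with N(r) <= 2T^2, T about Q^((1+delta)/4), and sort the pairs (p, b) by m = b r - b0 p. The pairs with m = 0 have associate p. For each other m the primes p lie in one residue class modulo r and in a disc whose area, compared with N(r), is at least a power Q^((1-delta)/2); there the sieve saves a factor (1 - delta) log Q, up to N(r)/phi(r) << log log Q, and the number of values of m balances the area of the disc.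

The sieve is Montgomery's: it reuses the large sieve inequality, now at the well-spaced fractions with denominators products of distinct primes not dividing r. *)
Require Import Defs.
From HB Require Import structures.
From mathcomp Require Import all_boot all_order all_algebra.
From mathcomp Require Import complex.
From mathcomp Require Import all_classical all_reals all_analysis.
From mathcomp Require Import zify ring lra.
Set Implicit Arguments. Unset Strict Implicit. Unset Printing Implicit Defensive.
Import Order.TTheory GRing.Theory Num.Theory.
Import numFieldNormedType.Exports.
Local Open Scope ring_scope.

(** * Arithmetic of Z[i] *)

(** The balance is exact. Let D be the squared radius around alpha within which fractions are
    counted, and H the larger of D and the squared error of the approximation b0/r. There are O(Q
    N(r) H) values of m, and for each of them the primes, divided by r after a shift, fill a disc of
    squared radius O(Q D / (H N(r))). The product O(Q^2 D) is free of r and H. The sieve gains only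
    the logarithm of the disc, so a lower bound for the disc that is uniform in r is what matters.
    If H = D it comes from N(r) <= 2 T^2 and has order Q / T^2; otherwise it comes from Dirichlet's
    bound on the error and has order Q D T^2. As D is of order 1 / N, both reach Q^((1-delta)/2) for
    T of order Q^((1+delta)/4).

    As delta tends to 1 the discs shrink to bounded size. The sieve bound therefore carries 1 + log
    M and not log M, which keeps the final constant uniform in delta.

    Every estimate on primes is extracted from the size of sums of 1 / N(n) over balls; no count of
    Gaussian primes is assumed. *)

(* [gint] is a pair type, on which mathcomp's canonical product is componentwise; the alias [zi] carries the ring structure of Z[i] instead. *)
Definition zi : Type := gint.

HB.instance Definition _ := Choice.copy zi (int * int)%type.

Definition zi_opp (x : zi) : zi := (- x.1, - x.2).

Fact zi_addA : associative (GI_gadd : zi -> zi -> zi).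
Proof. by move=> [a b] [c d] [e f]; congr (_, _); rewrite /= addrA. Qed.
Fact zi_addC : commutative (GI_gadd : zi -> zi -> zi).
Proof. by move=> [a b] [c d]; congr (_, _); rewrite /= addrC. Qed.
Fact zi_add0 : left_id (GI_gzero : zi) GI_gadd.
Proof. by move=> [a b]; congr (_, _); rewrite /= add0r. Qed.
Fact zi_addN : left_inverse (GI_gzero : zi) zi_opp GI_gadd.
Proof. by move=> [a b]; congr (_, _); rewrite /= addNr. Qed.
HB.instance Definition _ := GRing.isZmodule.Build zi zi_addA zi_addC zi_add0 zi_addN.

Fact zi_mulA : associative (GI_gmul : zi -> zi -> zi).
Proof. by move=> [a b] [c d] [e f]; rewrite /GI_gmul /=; congr (_, _); ring. Qed.
Fact zi_mulC : commutative (GI_gmul : zi -> zi -> zi).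
Proof. by move=> [a b] [c d]; rewrite /GI_gmul /=; congr (_, _); ring. Qed.
Fact zi_mul1 : left_id (GI_gone : zi) GI_gmul.
Proof. by move=> [a b]; rewrite /GI_gmul /GI_gone /=; congr (_, _); ring. Qed.
Fact zi_mulD : left_distributive (GI_gmul : zi -> zi -> zi) GI_gadd.
Proof. by move=> [a b] [c d] [e f]; rewrite /GI_gmul /GI_gadd /=; congr (_, _); ring. Qed.
Fact zi_1neq0 : (GI_gone : zi) != GI_gzero.
Proof. by []. Qed.
HB.instance Definition _ :=
  GRing.Zmodule_isComNzRing.Build zi zi_mulA zi_mulC zi_mul1 zi_mulD zi_1neq0.

Section GaussianIntegers.
Implicit Types x y d n m p q u v : zi.

Lemma zi_mulE (x y : zi) :
  x * y = (x.1 * y.1 - x.2 * y.2, x.1 * y.2 + x.2 * y.1) :> zi.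
Proof. by []. Qed.

Lemma zi_addE (x y : zi) : x + y = (x.1 + y.1, x.2 + y.2) :> zi.
Proof. by []. Qed.

Lemma zi_oppE (x : zi) : - x = (- x.1, - x.2) :> zi.
Proof. by []. Qed.

Lemma zi_subE (x y : zi) : x - y = GI_gsub x y.
Proof. by []. Qed.

Lemma zi_ext (x y : zi) : x.1 = y.1 -> x.2 = y.2 -> x = y.
Proof. by case: x y => [a b] [c d] /= -> ->. Qed.

Definition nrm (x : zi) : nat := (`|x.1| ^ 2 + `|x.2| ^ 2)%N.

Lemma nrmE (x : zi) : (nrm x)%:Z = x.1 ^+ 2 + x.2 ^+ 2.
Proof. by rewrite /nrm PoszD -!abszX !gez0_abs ?sqr_ge0. Qed.

Lemma nrm_gnorm (x : zi) : (nrm x)%:Z = GI_gnorm x.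
Proof. exact: nrmE. Qed.

Lemma nrmM (x y : zi) : nrm (x * y) = (nrm x * nrm y)%N.
Proof.
by apply/eqP; rewrite -eqz_nat PoszM !nrmE zi_mulE /=; apply/eqP; ring.
Qed.

Lemma nrm_eq0 (x : zi) : (nrm x == 0)%N = (x == 0).
Proof.
rewrite /nrm addn_eq0 !expn_eq0 !absz_eq0 !andbT.
by apply/andP/eqP => [[/eqP a /eqP b]|->]; [exact: zi_ext|].
Qed.

Lemma nrm_gt0 (x : zi) : (0 < nrm x)%N = (x != 0).
Proof. by rewrite lt0n nrm_eq0. Qed.

Lemma nrm1 : nrm 1 = 1%N. Proof. by []. Qed.

Lemma zi_mulf_eq0 (x y : zi) : (x * y == 0) = (x == 0) || (y == 0).
Proof. by rewrite -!nrm_eq0 nrmM muln_eq0. Qed.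

Lemma zi_mulfI (x : zi) : x != 0 -> injective ( *%R x).
Proof.
move=> x0 y z /eqP; rewrite -subr_eq0 -mulrBr zi_mulf_eq0 (negPf x0) subr_eq0.
by move/eqP.
Qed.

Definition zconj (x : zi) : zi := (x.1, - x.2).
Definition zint (a : int) : zi := (a, 0).

Lemma zi_mul_conj (x : zi) : x * zconj x = zint (nrm x)%:Z.
Proof. by rewrite /zint nrmE zi_mulE; apply: zi_ext => /=; ring. Qed.

Lemma nrm_conj x : nrm (zconj x) = nrm x.
Proof. by rewrite /nrm /zconj /= abszN. Qed.

(** A classical boolean, so that divisibility can serve in filters and in the conditions of big
    operators. *)
Definition zdvd (d n : zi) : bool := `[< exists k : zi, n = d * k >].

Lemma zdvdP (d n : zi) : reflect (exists k : zi, n = d * k) (zdvd d n).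
Proof. exact: asboolP. Qed.

Lemma gdvdP (d n : zi) : GI_gdvd d n <-> zdvd d n.
Proof. by split=> [h|/zdvdP //]; apply/zdvdP. Qed.

Lemma zdvd_refl d : zdvd d d.
Proof. by apply/zdvdP; exists 1; rewrite mulr1. Qed.
Lemma zdvd0 d : zdvd d 0.
Proof. by apply/zdvdP; exists 0; rewrite mulr0. Qed.
Lemma zdvd_trans d e n : zdvd d e -> zdvd e n -> zdvd d n.
Proof.
move=> /zdvdP[k ->] /zdvdP[l ->]; apply/zdvdP; exists (k * l); ring.
Qed.
Lemma zdvd_mulr d n m : zdvd d n -> zdvd d (n * m).
Proof. by move=> /zdvdP[k ->]; apply/zdvdP; exists (k * m); rewrite mulrA. Qed.
Lemma zdvd_mull d n m : zdvd d n -> zdvd d (m * n).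
Proof. by rewrite mulrC; exact: zdvd_mulr. Qed.
Lemma zdvdD d n m : zdvd d n -> zdvd d m -> zdvd d (n + m).
Proof.
by move=> /zdvdP[k ->] /zdvdP[l ->]; apply/zdvdP; exists (k + l); rewrite mulrDr.
Qed.
Lemma zdvdN d n : zdvd d (- n) = zdvd d n.
Proof.
apply/idP/idP => /zdvdP[k e]; apply/zdvdP; exists (- k); rewrite mulrN -e //.
by rewrite opprK.
Qed.
Lemma zdvdB d n m : zdvd d n -> zdvd d m -> zdvd d (n - m).
Proof. by move=> a b; apply: zdvdD => //; rewrite zdvdN. Qed.
Lemma zdvd_pmul2l c d n : c != 0 -> zdvd (c * d) (c * n) = zdvd d n.
Proof.
move=> c0; apply/idP/idP => /zdvdP[k e]; apply/zdvdP; exists k; last by rewrite e mulrA.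
by apply: (zi_mulfI c0); rewrite e mulrA.
Qed.
Lemma zdvd_nrm d n : zdvd d n -> n != 0 -> (nrm d <= nrm n)%N.
Proof.
move=> /zdvdP[k ->]; rewrite zi_mulf_eq0 negb_or => /andP[_ k0].
by rewrite nrmM leq_pmulr ?nrm_gt0.
Qed.
Lemma zdvd1 u : zdvd u 1 = (nrm u == 1)%N.
Proof.
apply/zdvdP/eqP => [[k e]|u1].
  have : (nrm u * nrm k)%N == 1%N by rewrite -nrmM -e.
  by rewrite muln_eq1 => /andP[/eqP].
by exists (zconj u); rewrite zi_mul_conj u1.
Qed.

(** * Euclidean division and Bezout relations *)

(** The nearest Gaussian integer to x / q = x conj(q) / m, coordinate by coordinate: floor((2 y + m)
    / (2 m)) rounds y / m. *)
Definition zquo (x q : zi) : zi :=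
  let m := (nrm q)%:Z in let y := x * zconj q in
  (((2 * y.1 + m) %/ (2 * m))%Z, ((2 * y.2 + m) %/ (2 * m))%Z).
Definition zrem (x q : zi) : zi := x - q * zquo x q.

(** Rounding commutes with integer translations. Hence [zrem] depends only on the class modulo [q]
    and can serve as canonical representative. *)
Lemma zquoD x q k : q != 0 -> zquo (x + q * k) q = zquo x q + k.
Proof.
rewrite -nrm_gt0 => q0; rewrite /zquo.
have -> : (x + q * k) * zconj q = x * zconj q + zint (nrm q) * k.
  by rewrite -zi_mul_conj; ring.
set m := (nrm q)%:Z; have m0 : 2 * m != 0 by rewrite /m; lia.
apply: zi_ext; rewrite zi_mulE zi_addE /=.
  have -> : forall y : int, 2 * (y + (m * k.1 - 0 * k.2)) + m = (2 * y + m) + k.1 * (2 * m).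
    by move=> y; ring.
  by rewrite addrC divzMDl // addrC.
have -> : forall y : int, 2 * (y + (m * k.2 + 0 * k.1)) + m = (2 * y + m) + k.2 * (2 * m).
  by move=> y; ring.
by rewrite addrC divzMDl // addrC.
Qed.

Lemma zremD x q k : q != 0 -> zrem (x + q * k) q = zrem x q.
Proof. by move=> q0; rewrite /zrem zquoD //; ring. Qed.

Lemma zrem_dvd x q : zdvd q (x - zrem x q).
Proof. by apply/zdvdP; exists (zquo x q); rewrite /zrem; ring. Qed.

Lemma eq_zrem x y q : q != 0 -> zdvd q (x - y) -> zrem x q = zrem y q.
Proof.
move=> q0 /zdvdP[k e]; rewrite -(zremD y k q0); congr zrem.
by rewrite -e; ring.
Qed.

Lemma zrem_id x q : q != 0 -> zrem (zrem x q) q = zrem x q.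
Proof.
move=> q0; apply: eq_zrem => //.
by rewrite -opprB zdvdN zrem_dvd.
Qed.

(** Rounding errs by at most 1/2 in each coordinate. After multiplication by [zconj q] each squared
    coordinate is at most a quarter of [nrm q] squared, so the norm is at least halved. *)
Lemma nrm_zrem x q : q != 0 -> (nrm (zrem x q) < nrm q)%N.
Proof.
rewrite -nrm_gt0 => q0; rewrite -(ltn_pmul2r q0) -[X in (_ * X < _)%N]nrm_conj -nrmM.
have -> : zrem x q * zconj q = x * zconj q - zint (nrm q) * zquo x q.
  by rewrite -zi_mul_conj /zrem; ring.
rewrite -ltz_nat PoszM nrmE /zquo; set y := x * zconj q; set m := (nrm q)%:Z.
rewrite /GI_gmul zi_addE zi_oppE zi_mulE /=.
have m0 : 0 < m by rewrite /m; lia.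
have key (z : int) : (2 * (z - m * ((2 * z + m) %/ (2 * m))%Z)) ^+ 2 <= m ^+ 2.
  have e := divz_eq (2 * z + m) (2 * m).
  have h0 : 0 <= ((2 * z + m) %% (2 * m))%Z by apply: modz_ge0; lia.
  have h1 : ((2 * z + m) %% (2 * m))%Z < 2 * m by rewrite ltz_pmod //; lia.
  have -> : 2 * (z - m * ((2 * z + m) %/ (2 * m))%Z) = ((2 * z + m) %% (2 * m))%Z - m.
    by move: e; lia.
  by nia.
have k1 := key y.1; have k2 := key y.2; move: k1 k2.
rewrite !mul0r subr0 addr0.
rewrite -[x.1 * q.1 - _]/(y.1) -[x.1 * - q.2 + _]/(y.2).
have fin (A B c : int) : 0 < c -> 4 * A <= c -> 4 * B <= c -> A + B < c by lia.
move=> k1 k2; apply: (fin _ _ (m ^+ 2)); first exact: exprn_gt0.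
  by move: k1; rewrite exprMn.
by move: k2; rewrite exprMn.
Qed.

Lemma zbezout (u v : zi) :
  exists g s t : zi, [/\ g = s * u + t * v, zdvd g u & zdvd g v].
Proof.
have [n] := ubnP (nrm v); elim: n u v => // n IH u v.
have [->|v0] := eqVneq v 0.
  by exists u, 1, 0; split; rewrite ?zdvd_refl ?zdvd0 //; ring.
move=> lt; have [g [s [t [e gv gr]]]] := IH v (zrem u v) (leq_trans (nrm_zrem u v0) lt).
exists g, t, (s - t * zquo u v); split => //; first by rewrite e /zrem; ring.
have -> : u = zrem u v + v * zquo u v by rewrite /zrem; ring.
by rewrite zdvdD // zdvd_mulr.
Qed.

(** * Gaussian primes *)

Definition zprime (p : zi) : bool := `[< GI_gprime p >].

Lemma zprimeP (p : zi) :
  reflect [/\ p != 0, nrm p != 1%N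
           & forall a b : zi, zdvd p (a * b) -> zdvd p a || zdvd p b] (zprime p).
Proof.
apply: (iffP (asboolP _)) => [[p0 [p1 h]]|[p0 p1 h]].
  split; first exact/eqP.
    by rewrite -zdvd1; apply/negP => /gdvdP.
  by move=> a b /gdvdP/h[] /gdvdP ->; rewrite ?orbT.
split; first exact/eqP.
split; first by move=> /gdvdP; rewrite zdvd1; exact/negP.
by move=> a b /gdvdP/h/orP[] ?; [left|right]; apply/gdvdP.
Qed.

Lemma zprime_neq0 p : zprime p -> p != 0.
Proof. by case/zprimeP. Qed.

Lemma zprime_nrm p : zprime p -> (1 < nrm p)%N.
Proof. by move=> /zprimeP[]; rewrite -nrm_gt0; lia. Qed.

Lemma zprimeM p a b : zprime p -> zdvd p (a * b) = zdvd p a || zdvd p b.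
Proof.
move=> /zprimeP[_ _ h]; apply/idP/orP => [/h/orP//|[]] ?; first exact: zdvd_mulr.
exact: zdvd_mull.
Qed.

Lemma neq_muln_self (a b c : nat) : (1 < a)%N -> (0 < b)%N -> b <> (a * (b * c))%N.
Proof.
move=> a1 b0 e; suff : (a * c = 1)%N by move/eqP; rewrite muln_eq1; lia.
by apply/eqP; rewrite -(eqn_pmul2l b0) mulnCA -e muln1.
Qed.

Lemma zprime_dvd_sym p q : zprime p -> zprime q -> zdvd p q -> zdvd q p.
Proof.
move=> pp pq /zdvdP[k e]; have := zdvd_refl q; rewrite {2}e (zprimeM _ _ pq).
case/orP => // /zdvdP[l el]; exfalso.
have [/ltnW q0 p1] := (zprime_nrm pq, zprime_nrm pp).
by apply: (@neq_muln_self (nrm p) (nrm q) (nrm l)) => //; rewrite {1}e el !nrmM.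
Qed.

Lemma zprime_dvd_nrm p q : zprime p -> zprime q -> zdvd p q -> nrm p = nrm q.
Proof.
move=> pp pq h; apply/eqP; rewrite eqn_leq.
by rewrite !zdvd_nrm ?zprime_neq0 // zprime_dvd_sym.
Qed.

(** The Bezout gcd g of [q] and [r] is a unit: from q = g k, primality gives q | g, excluded because
    q does not divide r, or q | k, which forces [nrm g] to be 1. *)
Lemma zprime_coprime_inv q r : zprime q -> ~~ zdvd q r ->
  exists t, zdvd q (1 - t * r).
Proof.
move=> pq nqr; have [g [s [t [e gq gr]]]] := zbezout q r.
have g1 : nrm g = 1%N.
  move/zdvdP: (gq) => [k ek]; have := zdvd_refl q; rewrite {2}ek (zprimeM _ _ pq).
  case/orP => [h|/zdvdP[l el]]; first by rewrite (zdvd_trans h gr) in nqr.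
  have q0 := ltnW (zprime_nrm pq).
  have E : nrm q = (nrm g * (nrm q * nrm l))%N by rewrite {1}ek el !nrmM.
  have g0 : (0 < nrm g)%N by move: q0; rewrite E; case: (nrm g).
  by apply/eqP; rewrite eqn_leq g0 andbT leqNgt; apply/negP => /neq_muln_self/(_ q0 E).
exists (zconj g * t); have : zconj g * g = 1 by rewrite mulrC zi_mul_conj g1.
rewrite {2}e => <-; apply/zdvdP; exists (zconj g * s); ring.
Qed.

(** If all nonunit divisors of [n] have the norm of [n], then [n] is prime by Bezout. Otherwise some
    nonunit divisor has smaller norm, and induction applies to it. *)
Lemma zprime_exists n : n != 0 -> nrm n != 1%N -> exists2 p, zprime p & zdvd p n.
Proof.
have [k] := ubnP (nrm n); elim: k n => // k IH n lt n0 n1.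
have [h|/existsNP[d /not_implyP[dn /not_implyP[d1 /eqP dn']]]] :=
  pselect (forall d, zdvd d n -> nrm d != 1%N -> nrm d = nrm n).
  exists n; last exact: zdvd_refl.
  apply/zprimeP; split => // a b hab; have [g [s [t [e gn ga]]]] := zbezout n a.
  have [/eqP g1|g1] := boolP (nrm g == 1%N).
    apply/orP; right; have : zconj g * g = 1 by rewrite mulrC zi_mul_conj g1.
    rewrite {2}e => E.
    have -> : b = n * (zconj g * s * b) + a * b * (zconj g * t).
      by rewrite -[LHS]mulr1 -E; ring.
    by apply: zdvdD; [exact: zdvd_mulr (zdvd_refl n) | exact: zdvd_mulr hab].
  have := h _ gn g1; move/zdvdP: gn => [l en]; rewrite en nrmM.
  have g0 : (0 < nrm g)%N.
    by rewrite nrm_gt0; apply: contraNneq n0 => g0; rewrite en g0 mul0r.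
  move=> E; have l1 : nrm l = 1%N by move: E g0; nia.
  apply/orP; left; apply: zdvd_trans ga; rewrite -(zdvd_pmul2l _ _ (c := zconj l)).
    have E1 : l * zconj l = 1 by rewrite zi_mul_conj l1.
    by apply/zdvdP; exists (zconj l); rewrite -[LHS]mulr1 -E1; ring.
  by rewrite -nrm_gt0 nrm_conj l1.
have lt' : (nrm d < nrm n)%N by rewrite ltn_neqAle dn' zdvd_nrm.
have d0 : d != 0 by apply: contraNneq n0 => d0; case/zdvdP: dn => l ->; rewrite d0 mul0r.
have [p pp pd] := IH d (leq_trans lt' lt) d0 d1.
by exists p => //; exact: zdvd_trans dn.
Qed.

(** * Boxes, balls and residue systems *)

Definition zbox (M : nat) : seq zi := GI_gbox M.

Lemma mem_zrange M (a : int) : (a \in GI_zrange M) = (`|a| <= M)%N.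
Proof.
apply/mapP/idP => [[k]|aM]; first by rewrite mem_iota => /andP[_ kM] ->; lia.
by exists (absz (a + M%:Z)); [rewrite mem_iota; lia|lia].
Qed.

Lemma uniq_zrange M : uniq (GI_zrange M).
Proof. by rewrite map_inj_uniq ?iota_uniq // => a b; lia. Qed.

Lemma mem_zbox M x : (x \in zbox M) = (`|x.1| <= M)%N && (`|x.2| <= M)%N.
Proof.
rewrite -!mem_zrange; apply/allpairsP/andP => [[[a b] /= [ha hb ->]]//|[ha hb]].
by exists x; split => //; case: (x).
Qed.

Lemma uniq_zbox M : uniq (zbox M).
Proof. by apply: allpairs_uniq; rewrite ?uniq_zrange // => -[a b] [c d]. Qed.

Lemma size_zbox M : size (zbox M) = (M.*2.+1 ^ 2)%N.
Proof. by rewrite size_allpairs !size_map !size_iota. Qed.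

Lemma zboxP M x : (nrm x <= M)%N -> x \in zbox M.
Proof. by rewrite mem_zbox /nrm; nia. Qed.

Definition zball (D : nat) : seq zi := [seq n <- zbox D | (0 < nrm n <= D)%N].

Lemma mem_zball D n : (n \in zball D) = (0 < nrm n <= D)%N.
Proof.
by rewrite mem_filter andbC; case: (boolP (n \in _)) => // /negP h; apply/esym/negP => /andP[_ /zboxP].
Qed.

Lemma uniq_zball D : uniq (zball D).
Proof. exact/filter_uniq/uniq_zbox. Qed.

Lemma sqrtn_exists (D : nat) : exists h : nat, (h ^ 2 <= D < h.+1 ^ 2)%N.
Proof.
elim: D => [|D [h /andP[h1 h2]]]; first by exists 0%N.
have [e|ne] := eqVneq D.+1 (h.+1 ^ 2)%N; first by exists h.+1; nia.
by exists h; lia.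
Qed.

(** With h = floor(sqrt D) the ball fits into a box of side 2 h + 1 <= 3 h. *)
Lemma size_zball D : (size (zball D) <= 9 * D)%N.
Proof.
have [h /andP[h1 h2]] := sqrtn_exists D.
have [->|D0] := posnP D; first by [].
apply: (@leq_trans (size (zbox h))); last by rewrite size_zbox; nia.
apply: uniq_leq_size (uniq_zball D) _ => n; rewrite mem_zball mem_zbox /nrm.
by move=> /andP[_ nD]; apply/andP; split; nia.
Qed.

(* With [g] the gcd of the coordinates of [q], the lattice q Z[i] has a triangular basis with diagonal [A = nrm q / g] and [g]; [f] below reads off a residue in that basis. *)
Lemma size_incongruent q (s : seq zi) : q != 0 -> uniq s ->
  {in s &, forall x y, zdvd q (x - y) -> x = y} -> (size s <= nrm q)%N.
Proof.
move=> q0 us inj; have [s1 [t1 eg]] := Bezoutz q.1 q.2.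
set g := gcdz q.1 q.2 in eg.
have g0 : 0 < g.
  rewrite lt_neqAle [(0 <= g)%R]isT andbT eq_sym gcdz_eq0; apply: contraNN q0.
  by move=> /andP[/eqP a /eqP b]; apply/eqP/zi_ext.
have /dvdzP[a ea] : (g %| q.1)%Z by exact: dvdz_gcdl.
have /dvdzP[b eb] : (g %| q.2)%Z by exact: dvdz_gcdr.
have e1 : s1 * a + t1 * b = 1.
  by apply: (mulIf (lt0r_neq0 g0)); rewrite mul1r -[RHS]eg ea eb; ring.
pose j := b * s1 - a * t1; pose A := g * (a ^+ 2 + b ^+ 2).
have qE : (nrm q)%:Z = A * g by rewrite nrmE ea eb /A; ring.
have A0 : 0 < A.
  have : 0 < A * g by rewrite -qE ltz_nat nrm_gt0.
  by rewrite pmulr_lgt0.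
pose f x := ((x.1 + j * x.2) %% A, x.2 %% g)%Z.
have finj : {in s &, injective f}.
  move=> x y xs ys /pair_equal_spec[/eqP h1 /eqP h2]; apply: inj => //.
  move: h1 h2; rewrite !eqz_mod_dvd => /dvdzP[u eu] /dvdzP[v ev].
  apply/zdvdP; exists (zconj (a, b) * zint u + ((t1, s1) : zi) * zint v).
  apply: zi_ext; rewrite !(zi_mulE, zi_addE, zi_oppE) /= !ea !eb.
    have -> : x.1 - y.1 = u * A - j * (v * g) by rewrite -eu -ev; ring.
    rewrite /A /j. ring.
  rewrite ev; transitivity (g * v * (s1 * a + t1 * b)); last by ring.
  by rewrite e1; ring.
rewrite -(size_map f) -lez_nat qE -(gez0_abs (ltW A0)) -(gez0_abs (ltW g0)) -PoszM lez_nat.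
pose r (n : int) := [seq k%:Z | k <- iota 0 `|n|%N].
have -> : (`|A| * `|g|)%N = size [seq (k, l) | k <- r A, l <- r g].
  by rewrite size_allpairs !size_map !size_iota.
apply: uniq_leq_size; first by rewrite map_inj_in_uniq.
move=> _ /mapP[x _ ->]; apply/allpairsP; exists (f x); split => //; rewrite /f /=.
  have := modz_ge0 (x.1 + j * x.2) (lt0r_neq0 A0); have := ltz_pmod (x.1 + j * x.2) A0.
  move: (_ %% _)%Z => w wA w0; apply/mapP; exists `|w|%N; last by lia.
  by rewrite mem_iota; lia.
have := modz_ge0 x.2 (lt0r_neq0 g0); have := ltz_pmod x.2 g0.
move: (_ %% _)%Z => w wA w0; apply/mapP; exists `|w|%N; last by lia.
by rewrite mem_iota; lia.
Qed.

(** The fixed points of [zrem]. The box holds all of them, since remainders have norm below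
    [nrm q]. *)
Definition zres q : seq zi := [seq b <- zbox (nrm q) | zrem b q == b].

Lemma mem_zres q b : q != 0 -> (b \in zres q) = (zrem b q == b).
Proof.
move=> q0; rewrite mem_filter; case: eqP => //= e; apply: zboxP.
by rewrite -e ltnW // nrm_zrem.
Qed.

Lemma zrem_in_zres q b : q != 0 -> zrem b q \in zres q.
Proof. by move=> q0; rewrite mem_zres // zrem_id. Qed.

Lemma uniq_zres q : uniq (zres q).
Proof. exact/filter_uniq/uniq_zbox. Qed.

Lemma zres_inj q : q != 0 -> {in zres q &, forall x y, zdvd q (x - y) -> x = y}.
Proof.
by move=> q0 x y; rewrite !mem_zres // => /eqP <- /eqP <- /(eq_zrem q0); rewrite !zrem_id.
Qed.

Lemma size_zres q : q != 0 -> (size (zres q) <= nrm q)%N.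
Proof. by move=> q0; apply: size_incongruent (zres_inj q0); rewrite ?uniq_zres. Qed.

Lemma zrem0 q : q != 0 -> zrem 0 q = 0.
Proof.
move=> q0; have e0 : zquo 0 q = 0.
  by rewrite /zquo mul0r /= !divz_small //; move: q0; rewrite -nrm_gt0; lia.
by rewrite /zrem e0 mulr0 subr0.
Qed.

Lemma zres0 q : q != 0 -> 0 \in zres q.
Proof. by move=> q0; rewrite mem_zres ?zrem0. Qed.

(** Translation permutes the residue classes; this invariance gives the orthogonality of characters
    in [sum_zres_chi]. *)
Lemma perm_zres_shift q b0 : q != 0 ->
  perm_eq (zres q) [seq zrem (b + b0) q | b <- zres q].
Proof.
move=> q0; apply: uniq_perm; rewrite ?uniq_zres //.
  rewrite map_inj_in_uniq ?uniq_zres // => x y xs ys /eqP e; apply: (zres_inj q0) => //.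
  have -> : x - y = (x + b0 - zrem (x + b0) q) - (y + b0 - zrem (y + b0) q).
    by rewrite (eqP e); ring.
  by rewrite zdvdB ?zrem_dvd.
move=> x; apply/idP/mapP => [xs|[b _ ->]]; last exact: zrem_in_zres.
exists (zrem (x - b0) q); first exact: zrem_in_zres.
move: xs; rewrite mem_zres // => /eqP {1}<-; apply: eq_zrem => //.
have -> : x - (zrem (x - b0) q + b0) = (x - b0) - zrem (x - b0) q by ring.
exact: zrem_dvd.
Qed.

(** One prime from each associate class, so that products over subsets stand for distinct squarefree
    ideals. *)
Definition nonassoc_primes (P : seq zi) : bool :=
  [&& uniq P, all zprime P & all (fun p => all (fun q => zdvd p q ==> (p == q)) P) P].

Lemma nonassoc_primesP (P : seq zi) :
  reflect [/\ uniq P, {in P, forall p, zprime p}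
            & {in P &, forall p q, zdvd p q -> p = q}] (nonassoc_primes P).
Proof.
apply: (iffP and3P) => [[u /allP pr /allP h]|[u pr h]]; split => //.
- by move=> p q /h/allP h' /h' /implyP H /H /eqP.
- exact/allP.
- apply/allP => p pP; apply/allP => q qP; apply/implyP => ?; apply/eqP; exact: h.
Qed.

Lemma nonassoc_cons p P : nonassoc_primes (p :: P) ->
  [/\ zprime p, nonassoc_primes P & {in P, forall q, ~~ zdvd p q /\ ~~ zdvd q p}].
Proof.
move=> /nonassoc_primesP[/= /andP[pP uP] pr h]; split.
- by apply: pr; rewrite mem_head.
- apply/nonassoc_primesP; split => // [q qP|q r qP rP]; first by apply: pr; rewrite inE qP orbT.
  by apply: h; rewrite inE ?qP ?rP orbT.
- move=> q qP; split; apply/negP => hd.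
    by move: (pP); rewrite (h p q) ?qP // ?inE ?eqxx ?qP ?orbT.
  by move: (pP); rewrite -(h q p) ?qP // ?inE ?eqxx ?qP ?orbT.
Qed.

Lemma nonassoc_filter (f : pred zi) P : nonassoc_primes P -> nonassoc_primes [seq p <- P | f p].
Proof.
move=> /nonassoc_primesP[u pr h]; apply/nonassoc_primesP; split.
- exact: filter_uniq.
- by move=> p; rewrite mem_filter => /andP[_]; exact: pr.
- by move=> p q; rewrite !mem_filter => /andP[_ ?] /andP[_ ?]; exact: h.
Qed.

(* Each nonzero Gaussian integer has exactly one associate with positive real and nonnegative imaginary part. *)
Definition primes_upto (D : nat) : seq zi :=
  [seq p <- zball D | zprime p && (0 < p.1) && (0 <= p.2)].

Lemma assoc_quadrant x : x != 0 ->
  exists u, [/\ nrm u = 1%N, 0 < (x * u).1 & 0 <= (x * u).2].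
Proof.
move=> x0; have : x.1 != 0 \/ x.2 != 0.
  have [a0|a0] := eqVneq x.1 0; [right|by left].
  by apply: contraNneq x0 => b0; apply/eqP/zi_ext.
move=> h; have : [\/ 0 < x.1 /\ 0 <= x.2, 0 < x.2 /\ x.1 <= 0,
  x.1 < 0 /\ x.2 <= 0 | x.2 < 0 /\ 0 <= x.1].
  have [] : (0 < x.1 /\ 0 <= x.2) \/ (0 < x.2 /\ x.1 <= 0) \/
    (x.1 < 0 /\ x.2 <= 0) \/ (x.2 < 0 /\ 0 <= x.1) by lia.
    by constructor 1.
  by move=> [|[]] ?; [constructor 2|constructor 3|constructor 4].
case=> -[h1 h2].
- by exists 1; rewrite mulr1.
- by exists ((0, -1) : zi); rewrite zi_mulE /=; split => //; lia.
- by exists (- 1 : zi); rewrite mulrN1 zi_oppE /=; split => //; lia.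
- by exists ((0, 1) : zi); rewrite zi_mulE /=; split => //; lia.
Qed.

Lemma sum_sq_eq1 (k l : nat) : (k ^ 2 + l ^ 2 = 1)%N ->
  (k = 1 /\ l = 0)%N \/ (k = 0 /\ l = 1)%N.
Proof.
rewrite -!mulnn; have [/eqP ->|k0] := boolP (k == 0)%N; first by nia.
by case: k k0 => [|[|k]] //; case: l => [|[|l]] // _; nia.
Qed.

Lemma unit_cases u : nrm u = 1%N ->
  [\/ u = (1, 0), u = (-1, 0), u = (0, 1) | u = (0, -1)].
Proof.
case: u => a b; rewrite /nrm /= => h.
have : [\/ a = 1 /\ b = 0, a = -1 /\ b = 0, a = 0 /\ b = 1 | a = 0 /\ b = -1].
  have : (`|a| = 1 /\ `|b| = 0)%N \/ (`|a| = 0 /\ `|b| = 1)%N.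
    exact: sum_sq_eq1 h.
  case=> -[h1 h2].
    have [] : a = 1 \/ a = -1 by lia.
      by constructor 1; split => //; lia.
    by constructor 2; split => //; lia.
  have [] : b = 1 \/ b = -1 by lia.
    by constructor 3; split => //; lia.
  by constructor 4; split => //; lia.
by case=> -[-> ->]; [constructor 1|constructor 2|constructor 3|constructor 4].
Qed.

Lemma primes_uptoP D : nonassoc_primes (primes_upto D).
Proof.
apply/nonassoc_primesP; split; first exact/filter_uniq/uniq_zball.
  by move=> p; rewrite mem_filter => /andP[/andP[/andP[]]].
move=> p q; rewrite !mem_filter => /andP[/andP[/andP[pp p1] p2] _].
move=> /andP[/andP[/andP[pq q1] q2] _] hd; have e := zprime_dvd_nrm pp pq hd.
case/zdvdP: hd => k ek; have k1 : nrm k = 1%N.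
  move: e (ltnW (zprime_nrm pp)); rewrite ek nrmM => e p0.
  by apply/eqP; rewrite -(eqn_pmul2l p0) muln1 -e.
move: q1 q2; rewrite {}ek zi_mulE.
(* Multiplication by a unit is a rotation by quarter turns; only the unit 1 preserves the half-open
   quadrant. *)
by case: (unit_cases k1) => -> /=; [rewrite -[LHS]mulr1 => _ _|lia..].
Qed.

Lemma primes_upto_assoc D p : zprime p -> (nrm p <= D)%N ->
  exists2 q, q \in primes_upto D & zdvd p q.
Proof.
move=> pp pD; have [u [u1 h1 h2]] := assoc_quadrant (zprime_neq0 pp).
have h : zdvd p (p * u) by rewrite zdvd_mulr ?zdvd_refl.
exists (p * u) => //; rewrite mem_filter mem_zball nrmM u1 muln1 pD h1 h2 !andbT.
rewrite (ltnW (zprime_nrm pp)) andbT; apply/zprimeP; split.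
- by rewrite -nrm_gt0 nrmM u1 muln1 (ltnW (zprime_nrm pp)).
- by rewrite nrmM u1 muln1; case/zprimeP: pp.
- have e : zdvd (p * u) =1 zdvd p.
    move=> n; apply/idP/idP => [|hn]; first exact: zdvd_trans.
    apply: zdvd_trans hn; apply/zdvdP; exists (zconj u).
    by rewrite -mulrA zi_mul_conj u1 mulr1.
  by move=> a b; rewrite !e (zprimeM _ _ pp).
Qed.

Lemma primes_upto_nrm D : {in primes_upto D, forall p, (nrm p <= D)%N}.
Proof. by move=> p; rewrite mem_filter mem_zball => /andP[_ /andP[]]. Qed.

End GaussianIntegers.

(** * Reciprocal sums over Z[i] *)

Section SumsOverGaussianIntegers.
Variable R : realType.
Implicit Types x y d n m p q u v : zi.
Local Notation nR q := ((nrm q)%:R : R).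

Lemma eq_big_uniq (I : eqType) (V : nmodType) (s1 s2 : seq I) (F : I -> V) :
  uniq s1 -> uniq s2 -> s1 =i s2 -> \sum_(i <- s1) F i = \sum_(i <- s2) F i.
Proof. by move=> u1 u2 e; apply: perm_big; apply: uniq_perm. Qed.

Lemma ler_sum_sub (I : eqType) (s1 s2 : seq I) (F : I -> R) :
  uniq s1 -> uniq s2 -> {subset s1 <= s2} -> (forall i, i \in s2 -> 0 <= F i) ->
  \sum_(i <- s1) F i <= \sum_(i <- s2) F i.
Proof.
move=> u1 u2 s12 F0; rewrite (eq_big_uniq _ u1 (filter_uniq (mem s1) u2)); last first.
  by move=> i; rewrite mem_filter inE; case: (boolP (i \in s1)) => // /s12 ->.
rewrite big_filter big_mkcond big_seq [leRHS]big_seq; apply: ler_sum => i i2.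
by case: ifP => // _; exact: F0.
Qed.

Lemma ln_le_sub1 (x : R) : 0 < x -> ln x <= x - 1.
Proof. by move=> x0; have := @le_ln1Dx R (x - 1); rewrite subrKC; apply; lra. Qed.

Lemma harmonic_ge (m : nat) : ln (m.+1%:R : R) <= \sum_(1 <= k < m.+1) (k%:R : R)^-1.
Proof.
elim: m => [|m IH]; first by rewrite ln1 big_geq.
rewrite big_nat_recr //=; apply: le_trans (lerD IH (lexx _)).
have h1 : (0 : R) < m.+1%:R by rewrite ltr0n.
have -> : m.+2%:R = (m.+2%:R / m.+1%:R) * m.+1%:R :> R by rewrite divfK // lt0r_neq0.
rewrite lnM ?posrE ?divr_gt0 ?ltr0n // addrC lerD2l.
apply: le_trans (ln_le_sub1 _) _; first by rewrite divr_gt0 ?ltr0n.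
rewrite -[m.+2]addn1 natrD mulrDl divff ?lt0r_neq0 //.
by rewrite addrC addKr mul1r.
Qed.

Lemma harmonic_le (m : nat) : (0 < m)%N ->
  \sum_(1 <= k < m.+1) (k%:R : R)^-1 <= 1 + ln (m%:R : R).
Proof.
elim: m => [//|[|m] IH _]; first by rewrite big_nat1 ln1 invr1 addr0.
rewrite big_nat_recr //=; apply: le_trans (lerD (IH isT) (lexx _)) _.
have h1 : (0 : R) < m.+1%:R by rewrite ltr0n.
have h2 : (0 : R) < m.+2%:R by rewrite ltr0n.
have e1 : m.+1%:R = (m.+1%:R / m.+2%:R) * m.+2%:R :> R by rewrite divfK // lt0r_neq0.
rewrite [X in 1 + ln X]e1 lnM ?posrE ?divr_gt0 //.
have := @ln_le_sub1 (m.+1%:R / m.+2%:R); rewrite divr_gt0 // => /(_ isT).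
have -> : m.+1%:R / m.+2%:R - 1 = - m.+2%:R^-1 :> R.
  apply: (mulIf (lt0r_neq0 h2)); rewrite mulrBl divfK ?lt0r_neq0 // mulNr mulVf ?lt0r_neq0 //.
  by rewrite mul1r -natr1; ring.
have key (a b c : R) : a <= - c -> 1 + (a + b) + c <= 1 + b by lra.
exact: key.
Qed.

Lemma sum_inv_sq_le (m : nat) : \sum_(1 <= k < m.+1) (k%:R ^+ 2 : R)^-1 <= 2.
Proof.
case: m => [|m]; first by rewrite big_geq.
(* Strengthened by a telescoping term so that the induction closes. *)
suff : \sum_(1 <= k < m.+2) (k%:R ^+ 2 : R)^-1 <= 2 - m.+1%:R^-1.
  by move/le_trans; apply; rewrite lerBlDr lerDl invr_ge0.
elim: m => [|m IH]; first by rewrite big_nat1 expr1n invr1; lra.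
rewrite big_nat_recr //=; apply: le_trans (lerD IH (lexx _)) _.
have h0 : (0 : R) < m.+1%:R by rewrite ltr0n.
rewrite -[m.+2%:R]natr1; set t := m.+1%:R in h0 *.
rewrite -subr_ge0.
have -> : 2 - (t + 1)^-1 - (2 - t^-1 + ((t + 1) ^+ 2)^-1) = (t * (t + 1) ^+ 2)^-1 :> R.
  by field; rewrite !lt0r_neq0 //; lra.
by rewrite invr_ge0 mulr_ge0 ?sqr_ge0 // ltW.
Qed.

(** Summation over square rings: the ring max(|x|, |y|) = k has 8 k points, all of norm at least
    k^2, and [F] decreases. *)
Lemma zbox_sum_le (F : nat -> R) (h : nat) :
  (forall a, 0 <= F a) -> (forall a b : nat, (0 < a <= b)%N -> F b <= F a) ->
  \sum_(n <- zbox h | n != 0) F (nrm n) <= \sum_(1 <= k < h.+1) 8 * k%:R * F (k ^ 2)%N.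
Proof.
move=> F0 Fm; elim: h => [|h IH].
  rewrite [leRHS]big_geq // big1_seq // => n /andP[n0]; rewrite mem_zbox => /andP[a b].
  by case/eqP: n0; apply: zi_ext => /=; lia.
rewrite big_nat_recr //= (bigID (mem (zbox h))) /=; apply: lerD.
  rewrite -big_filter; apply: le_trans IH; rewrite -[leRHS]big_filter le_eqVlt.
  apply/orP; left; apply/eqP; apply: eq_big_uniq; try exact/filter_uniq/uniq_zbox.
  move=> n; rewrite !mem_filter /= -andbA; congr andb.
  by rewrite andb_idr // !mem_zbox => /andP[a b]; rewrite !leqW.
have Fle n : n \notin zbox h -> F (nrm n) <= F (h.+1 ^ 2)%N.
  by move=> nh; apply: Fm; rewrite expn_gt0 /=; move: nh; rewrite mem_zbox /nrm; nia.
apply: le_trans (_ : \sum_(n <- zbox h.+1 | (n != 0) && (n \notin zbox h)) F (h.+1 ^ 2)%N <= _).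
  by apply: ler_sum => n /andP[_]; exact: Fle.
rewrite big_const_seq iter_addr_0 -[_ *+ count _ _]mulr_natl -natrM.
apply: ler_wpM2r => //; rewrite ler_nat.
apply: (@leq_trans (count (predC (mem (zbox h))) (zbox h.+1))).
  by apply: sub_count => n /andP[].
rewrite -(leq_add2l (count (mem (zbox h)) (zbox h.+1))) count_predC size_zbox.
have -> : count (mem (zbox h)) (zbox h.+1) = size (zbox h).
  rewrite -size_filter; apply: perm_size; apply: uniq_perm; rewrite ?filter_uniq ?uniq_zbox //.
  move=> n; rewrite mem_filter /= andb_idr // !mem_zbox => /andP[a b].
  by rewrite !leqW.
by rewrite size_zbox; nia.
Qed.

Definition recip_sum (D : nat) : R := \sum_(n <- zball D) (nR n)^-1.

Lemma recip_sum_le (D : nat) : (0 < D)%N -> recip_sum D <= 8 * (1 + ln D%:R).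
Proof.
move=> D0; apply: le_trans (_ : \sum_(n <- zbox D | n != 0) (nR n)^-1 <= _).
  rewrite -[leRHS]big_filter; apply: ler_sum_sub.
  - exact: uniq_zball.
  - exact/filter_uniq/uniq_zbox.
  - by move=> n; rewrite mem_zball mem_filter -nrm_gt0 => /andP[-> /zboxP].
  - by move=> n _; rewrite invr_ge0.
apply: le_trans (@zbox_sum_le (fun k => (k%:R)^-1) D _ _) _.
- by move=> a; rewrite invr_ge0.
- by move=> a b /andP[a0 ab]; rewrite lef_pV2 ?posrE ?ltr0n ?ler_nat // (leq_trans a0).
apply: le_trans (ler_wpM2l _ (harmonic_le D0)) => //; rewrite mulr_sumr big_nat [leRHS]big_nat.
apply: ler_sum => k /andP[k0 _]; rewrite natrX -mulrA.
have -> // : k%:R / k%:R ^+ 2 = k%:R^-1 :> R by field; rewrite pnatr_eq0 -lt0n.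
Qed.

Lemma sum_inv_nrm_sq_le (s : seq zi) : uniq s -> (forall n, n \in s -> n != 0) ->
  \sum_(n <- s) ((nR n) ^+ 2)^-1 <= 16.
Proof.
move=> us s0; pose D := \max_(n <- s) nrm n.
apply: le_trans (_ : \sum_(n <- zbox D | n != 0) ((nR n) ^+ 2)^-1 <= _).
  rewrite -[leRHS]big_filter; apply: ler_sum_sub => //.
  - exact/filter_uniq/uniq_zbox.
  - move=> n ns; rewrite mem_filter s0 // zboxP //.
    by rewrite /D (big_rem n ns) /= leq_maxl.
apply: le_trans (@zbox_sum_le (fun k => (k%:R ^+ 2)^-1) D _ _) _.
- by move=> a; rewrite invr_ge0 sqr_ge0.
- move=> a b /andP[a0 ab]; have b0 := leq_trans a0 ab.
  by rewrite lef_pV2 ?posrE ?exprn_gt0 ?ltr0n // lerXn2r ?nnegrE ?ler_nat.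
have -> : 16 = 8 * 2 :> R by ring.
apply: le_trans (ler_wpM2l _ (sum_inv_sq_le D)) => //; rewrite mulr_sumr big_nat [leRHS]big_nat.
apply: ler_sum => k /andP[k0 _]; rewrite natrX -mulrA ler_wpM2l //.
have k1 : (1 : R) <= k%:R by rewrite ler1n.
have k0' : (0 : R) < k%:R by rewrite ltr0n.
rewrite ler_pdivrMr ?exprn_gt0 // mulrC.
have -> : k%:R ^+ 2 ^+ 2 / k%:R ^+ 2 = k%:R ^+ 2 :> R by field; rewrite lt0r_neq0.
by rewrite expr2 ler_pMr.
Qed.

Lemma recip_sum_ge1 (D : nat) : (0 < D)%N -> 1 <= recip_sum D.
Proof.
move=> D0; rewrite /recip_sum (big_rem (1 : zi)) ?mem_zball ?nrm1 //= invr1 lerDl.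
by rewrite sumr_ge0 // => n _; rewrite invr_ge0.
Qed.

(** The triangle 1 <= j <= k <= m with m = floor(sqrt(D / 2)) lies in the ball. Its k points with
    second coordinate k have norm at most 2 k^2 and contribute at least 1 / (2 k) together. The
    bound 1 coming from n = 1 absorbs the additive constants. *)
Lemma recip_sum_ge (D : nat) : (0 < D)%N -> (1 + ln D%:R) / 8 <= recip_sum D.
Proof.
move=> D0; have [m /andP[m1 m2]] := sqrtn_exists (D %/ 2).
have lo : ln m.+1%:R / 2 <= recip_sum D.
  pose s : seq zi := [seq (j%:Z, k%:Z) | k <- iota 1 m, j <- iota 1 k].
  have us : uniq s.
    apply: allpairs_uniq_dep => [|k _|]; rewrite ?iota_uniq //.
    by move=> [a b] [c d] _ _ /= [<- <-].
  apply: le_trans (_ : \sum_(n <- s) (nR n)^-1 <= _); last first.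
    apply: ler_sum_sub; rewrite ?uniq_zball // => n.
    move=> /allpairsPdep[k [j [+ + ->]]]; rewrite !mem_iota mem_zball /nrm /=.
    move: (leq_trunc_div D 2) => h1 h2 h3; apply/andP; split; nia.
  rewrite /s big_allpairs_dep /= -[m]/(m.+1.-1).
  have -> : iota 1 m = index_iota 1 m.+1 by rewrite /index_iota subn1.
  apply: le_trans (ler_wpM2r _ (harmonic_ge m)) _; first by rewrite invr_ge0.
  rewrite mulr_suml [leLHS]big_nat [leRHS]big_nat; apply: ler_sum => k /andP[k0 _].
  have k0' : (0 : R) < k%:R by rewrite ltr0n.
  apply: le_trans (_ : \sum_(j <- iota 1 k) (2 * k%:R ^+ 2)^-1 <= _).
    rewrite big_const_seq count_predT size_iota iter_addr_0 -[leRHS]mulr_natl.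
    have -> // : k%:R * (2 * k%:R ^+ 2)^-1 = k%:R^-1 / 2 :> R.
    by field; rewrite lt0r_neq0.
  rewrite big_seq [leRHS]big_seq; apply: ler_sum => j; rewrite mem_iota => /andP[j0 j1].
  rewrite lef_pV2 ?posrE ?mulr_gt0 ?exprn_gt0 ?ltr0n ?nrm_gt0 //; last first.
    by apply/eqP => -[/eqP]; case: (j) j0.
  by rewrite -natrX -natrM ler_nat /nrm /=; nia.
have h1 : ln D%:R <= 1 + 2 * ln (m.+1%:R : R).
  have D1 : (0 : R) < D%:R by rewrite ltr0n.
  have m0 : (0 : R) < m.+1%:R by rewrite ltr0n.
  have : ln (D%:R : R) <= ln (2 * m.+1%:R ^+ 2).
    rewrite ler_ln ?posrE ?mulr_gt0 ?exprn_gt0 // -natrX -natrM ler_nat.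
    by move: m2 (ltn_ceil D (isT : 0 < 2)%N); lia.
  rewrite lnM ?posrE ?exprn_gt0 // lnXn // => /le_trans; apply.
  have := @ln_le_sub1 2 (ltr0n _ 2); set a := ln 2; set b := ln m.+1%:R; lra.
have h2 := recip_sum_ge1 D0; move: h1 h2 lo.
set a := ln D%:R; set b := ln m.+1%:R; set c := recip_sum D; lra.
Qed.

(** * Smooth numbers and the squarefree sums of the sieve *)

Definition smooth (P : seq zi) n : bool :=
  `[< forall p, zprime p -> zdvd p n -> exists2 q, q \in P & zdvd p q >].

Definition smooth_recip_sum (P : seq zi) (D : nat) : R :=
  \sum_(n <- zball D | smooth P n) (nR n)^-1.

Lemma zball_dvdE q (D : nat) : q != 0 ->
  [seq n <- zball D | zdvd q n] =i [seq q * n | n <- zball (D %/ nrm q)].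
Proof.
move=> q0 n; rewrite mem_filter mem_zball; apply/andP/mapP.
  have nq : (0 < nrm q)%N by rewrite nrm_gt0.
  move=> [/zdvdP[k ->] h]; exists k => //; move: h.
  by rewrite mem_zball nrmM muln_gt0 nq /= leq_divRL // mulnC.
move=> [k + ->]; rewrite mem_zball zdvd_mulr ?zdvd_refl // nrmM muln_gt0 leq_divRL ?nrm_gt0 //.
by rewrite q0 /= [(nrm k * _)%N]mulnC.
Qed.

Lemma sum_zball_dvd q (D : nat) (f : pred zi) : q != 0 ->
  \sum_(n <- zball D | zdvd q n && f n) (nR n)^-1 =
  (nR q)^-1 * \sum_(n <- zball (D %/ nrm q) | f (q * n)) (nR n)^-1.
Proof.
move=> q0; rewrite mulr_sumr.
transitivity (\sum_(n <- [seq q * n | n <- zball (D %/ nrm q)] | f n) (nR n)^-1).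
  rewrite -big_filter_cond; apply: perm_big; apply: uniq_perm; last exact: zball_dvdE.
    exact/filter_uniq/uniq_zball.
  by rewrite map_inj_uniq ?uniq_zball //; exact: zi_mulfI.
rewrite big_map; apply: eq_bigr => n _.
by rewrite nrmM natrM invfM.
Qed.

Lemma smooth_cons_dvd q P n : zprime q -> smooth (q :: P) (q * n) = smooth (q :: P) n.
Proof.
move=> pq; apply/asboolP/asboolP => h p pp.
  by move=> pn; apply: h => //; exact: zdvd_mull.
rewrite (zprimeM _ _ pp) => /orP[pdq|]; last exact: h.
by exists q; rewrite ?mem_head.
Qed.

Lemma smooth_cons_ndvd q P n : zprime q -> ~~ zdvd q n ->
  smooth (q :: P) n = smooth P n.
Proof.
move=> pq qn; apply/asboolP/asboolP => h p pp pn.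
  have [r] := h p pp pn; rewrite inE => /orP[/eqP ->|rP pr]; last by exists r.
  by move=> /(zprime_dvd_sym pp pq) /zdvd_trans/(_ pn); rewrite (negPf qn).
by have [r rP pr] := h p pp pn; exists r; rewrite // inE rP orbT.
Qed.

(** A split by divisibility by [q]. The multiples are q n with n again smooth over q :: P, so the
    right side refers to the same list with a smaller bound. *)
Lemma smooth_recip_sum_cons q P (D : nat) : nonassoc_primes (q :: P) ->
  smooth_recip_sum (q :: P) D =
  smooth_recip_sum P D + (nR q)^-1 * smooth_recip_sum (q :: P) (D %/ nrm q).
Proof.
move=> /nonassoc_cons[pq _ qP]; have q0 := zprime_neq0 pq.
rewrite {1}/smooth_recip_sum (bigID (zdvd q)) /= addrC; congr (_ + _).
  apply: eq_bigl => n; have [qn|qn] := boolP (zdvd q n); last by rewrite smooth_cons_ndvd ?andbT.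
  rewrite andbF; apply/esym/asboolP => /(_ q pq qn)[r /qP[/negP h _]].
  exact: h.
under eq_bigl => n do rewrite andbC; rewrite sum_zball_dvd //; congr (_ * _).
by apply: eq_bigl => n; rewrite smooth_cons_dvd.
Qed.

(* Sum of [\prod_(q in S) w q] over the subsets [S] of [P] with [\prod_(q in S) nrm q <= D]. *)
Fixpoint subset_sum (w : zi -> R) (P : seq zi) (D : nat) : R :=
  if P is q :: P' then subset_sum w P' D + w q * subset_sum w P' (D %/ nrm q)
  else (0 < D)%:R.

Lemma subset_sum_ge0 w P D : (forall q, q \in P -> 0 <= w q) -> 0 <= subset_sum w P D.
Proof.
elim: P D => [|q P IH] D h; first exact: ler0n.
have h' r : r \in P -> 0 <= w r by move=> rP; rewrite h // inE rP orbT.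
by rewrite /= addr_ge0 ?mulr_ge0 ?IH ?h ?mem_head.
Qed.

Lemma subset_sum_mono w P D D' : (forall q, q \in P -> 0 <= w q) -> (D <= D')%N ->
  subset_sum w P D <= subset_sum w P D'.
Proof.
elim: P D D' => [|q P IH] D D' h DD' /=; first by rewrite ler_nat; move: DD'; lia.
have h' r : r \in P -> 0 <= w r by move=> rP; rewrite h // inE rP orbT.
by rewrite lerD ?ler_wpM2l ?IH ?h ?mem_head // leq_div2r.
Qed.

(** A discarded prime costs at most its full factor 1 + w q, the bound on norms being relaxed to
    [D]. For [phi_weight] and discarded primes dividing r these factors multiply to at most N(r) /
    phi(r). *)
Lemma subset_sum_filter w P D (f : pred zi) : (forall q, q \in P -> 0 <= w q) ->
  subset_sum w P D <= subset_sum w [seq q <- P | f q] D * \prod_(q <- P | ~~ f q) (1 + w q).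
Proof.
elim: P D => [|q P IH] D h /=; first by rewrite big_nil mulr1.
have h' r : r \in P -> 0 <= w r by move=> rP; rewrite h // inE rP orbT.
have w0 : 0 <= w q by rewrite h ?mem_head.
rewrite big_cons; case: (f q) => /=.
  rewrite mulrDl lerD ?IH // -mulrA ler_wpM2l // IH //.
apply: le_trans (_ : (1 + w q) * subset_sum w P D <= _).
  by rewrite mulrDl mul1r lerD2l ler_wpM2l // subset_sum_mono // leq_div.
by rewrite mulrCA ler_wpM2l ?IH // addr_ge0.
Qed.

Lemma smooth_nil n : n != 0 -> smooth [::] n = (nrm n == 1%N).
Proof.
move=> n0; apply/asboolP/idP => [h|/eqP n1 p pp /zdvd_nrm/(_ n0)]; last first.
  by rewrite n1 leqNgt zprime_nrm.
by apply: contraT => n1; have [p pp /(h p pp)[]] := zprime_exists n0 n1.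
Qed.

Lemma smooth_recip_sum_nil D : smooth_recip_sum [::] D = 4 * (0 < D)%:R.
Proof.
have [->|D0] := posnP D.
  by rewrite /smooth_recip_sum /zball mulr0 big_filter_cond big1 // => n; lia.
pose us : seq zi := [:: (1, 0); (-1, 0); (0, 1); (0, -1)].
transitivity (\sum_(n <- us) (nR n)^-1); last first.
  by rewrite /us !big_cons big_nil /= invr1; ring.
rewrite /smooth_recip_sum -big_filter; apply: eq_big_uniq => //.
  exact/filter_uniq/uniq_zball.
move=> n; rewrite mem_filter mem_zball; apply/idP/idP.
  move=> /andP[sn /andP[n0 _]]; move: sn; rewrite smooth_nil -?nrm_gt0 // => /eqP.
  by move=> /unit_cases[] ->.
by rewrite !inE => /or4P[] /eqP ->; rewrite smooth_nil.
Qed.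

(** 1 / phi(q), the weight of a prime in Montgomery's sieve when one residue class is removed. *)
Definition phi_weight q : R := (nR q - 1)^-1.
Definition norm_weight q : R := (nR q)^-1.

Lemma nR_gt1 q : zprime q -> 1 < nR q.
Proof. by move=> /zprime_nrm; rewrite ltr1n. Qed.

Lemma phi_weight_ge0 q : zprime q -> 0 <= phi_weight q.
Proof. by move=> /nR_gt1 h; rewrite invr_ge0 subr_ge0 ltW. Qed.

(** Each n is charged to the product of its distinct primes: 1 / (nrm q - 1) is the geometric series
    of the powers of 1 / nrm q. The factor 4 counts the units. The inner induction on [D] strips off
    the powers of q. *)
Lemma smooth_recip_sum_le P D : nonassoc_primes P ->
  smooth_recip_sum P D <= 4 * subset_sum phi_weight P D.
Proof.
elim: P D => [|q P IH] D pP; first by rewrite smooth_recip_sum_nil.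
have [pq pP' _] := nonassoc_cons pP; have q1 := nR_gt1 pq.
have w0 r : r \in P -> 0 <= phi_weight r.
  by case/nonassoc_primesP: pP' => _ h _ /h/phi_weight_ge0.
have [k] := ubnP D; elim: k D => // k IHk D Dk; rewrite smooth_recip_sum_cons //=.
have [->|D0] := posnP D.
  rewrite div0n; have z s : smooth_recip_sum s 0 = 0.
    by rewrite /smooth_recip_sum /zball big_filter_cond big1 // => n; lia.
  by rewrite !z mulr0 addr0 mulr_ge0 // addr_ge0 ?mulr_ge0 ?subset_sum_ge0 ?phi_weight_ge0.
have lt : (D %/ nrm q < k)%N by apply: leq_trans (ltn_Pdiv (zprime_nrm pq) D0) _; lia.
apply: le_trans (lerD (IH _ pP') (ler_wpM2l _ (IHk _ lt))) _; first by rewrite invr_ge0; lra.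
have le : subset_sum phi_weight P (D %/ nrm q %/ nrm q) <= subset_sum phi_weight P (D %/ nrm q).
  by apply: subset_sum_mono => //; exact: leq_div.
(* The geometric series in fixed-point form. *)
have pw : phi_weight q = (nR q)^-1 * (1 + phi_weight q).
  by rewrite /phi_weight; field; rewrite !lt0r_neq0 //; lra.
have : (nR q)^-1 * (subset_sum phi_weight P (D %/ nrm q) +
    phi_weight q * subset_sum phi_weight P (D %/ nrm q %/ nrm q)) <=
    phi_weight q * subset_sum phi_weight P (D %/ nrm q).
  rewrite [in leRHS]pw -mulrA ler_wpM2l ?invr_ge0 ?mulrDl ?mul1r ?lerD2l //.
  by rewrite ler_wpM2l ?phi_weight_ge0.
rewrite /=; move: ((nR q)^-1) (phi_weight q) => i w.
move: (subset_sum _ _ _) (subset_sum _ _ _) (subset_sum _ _ _) => A B C; lra.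
Qed.

Lemma smooth_recip_sum_all P D : {in zball D, forall n, smooth P n} ->
  smooth_recip_sum P D = recip_sum D.
Proof.
move=> h; rewrite /smooth_recip_sum big_seq_cond /recip_sum [RHS]big_seq.
by apply: eq_bigl => n; rewrite andb_idr // => /h.
Qed.

(** All n in the ball are smooth over the primes up to [D], so the sieve sum inherits the size of
    the reciprocal sum; 32 is 8 from [recip_sum_ge] times the 4 units. *)
Lemma subset_sum_phi_ge D : (0 < D)%N ->
  (1 + ln D%:R) / 32 <= subset_sum phi_weight (primes_upto D) D.
Proof.
move=> D0; have := smooth_recip_sum_le D (primes_uptoP D).
rewrite smooth_recip_sum_all; last first.
  move=> n; rewrite mem_zball => /andP[n0 nD]; apply/asboolP => p pp pn.
  by apply: primes_upto_assoc; rewrite // (leq_trans _ nD) // zdvd_nrm -?nrm_gt0.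
by have := recip_sum_ge D0; lra.
Qed.

Lemma norm_weight_ge0 q : 0 <= norm_weight q.
Proof. by rewrite invr_ge0. Qed.

Lemma smooth_recip_sum_ge P D : nonassoc_primes P ->
  subset_sum norm_weight P D <= smooth_recip_sum P D.
Proof.
elim: P D => [|q P IH] D pP; first by rewrite smooth_recip_sum_nil /=; case: (0 < D)%N => /=; lra.
have [_ pP' _] := nonassoc_cons pP; rewrite smooth_recip_sum_cons //=.
rewrite lerD ?IH // ler_wpM2l ?norm_weight_ge0 //; apply: le_trans (IH _ pP') _.
rewrite smooth_recip_sum_cons // addrC; set t := smooth_recip_sum P _.
have e := smooth_recip_sum_cons (D %/ nrm q) pP; rewrite lerDr.
by rewrite mulr_ge0 ?invr_ge0 // sumr_ge0 // => n _; rewrite invr_ge0.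
Qed.

Lemma smooth_recip_sum_le_all P D : smooth_recip_sum P D <= recip_sum D.
Proof.
rewrite /smooth_recip_sum big_mkcond; apply: ler_sum => n _.
by case: ifP => // _; rewrite invr_ge0.
Qed.

Lemma subset_sum_le_prod w P D : (forall q, q \in P -> 0 <= w q) ->
  subset_sum w P D <= \prod_(q <- P) (1 + w q).
Proof.
elim: P D => [|q P IH] D h; first by rewrite big_nil /= lern1; case: (0 < D)%N.
have h' r : r \in P -> 0 <= w r by move=> rP; rewrite h // inE rP orbT.
rewrite big_cons mulrDl mul1r /= lerD ?IH // ler_wpM2l ?IH //.
by rewrite h ?mem_head.
Qed.

(** * Euler products and the bound for N(r) / phi(r) *)

Lemma divn_succ_bound (D n : nat) : (0 < n)%N -> (D.+1 <= n * (D %/ n).+1)%N.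
Proof. by move=> n0; rewrite mulnC ltn_ceil. Qed.

(* Rankin-style: a subset of norm product above [D] is counted with weight the logarithm of that product over [ln D.+1], and the logarithm is then split over its primes. *)
Lemma subset_sum_tail P D : {in P, forall q, zprime q} ->
  (\prod_(q <- P) (1 + norm_weight q) - subset_sum norm_weight P D) * ln (D.+1%:R : R) <=
  \prod_(q <- P) (1 + norm_weight q) * \sum_(q <- P) ln (nR q) / nR q.
Proof.
elim: P D => [|q P IH] D pr /=.
  rewrite !big_nil mulr0; case: D => [|D] /=; first by rewrite ln1 mulr0.
  by rewrite subrr mul0r.
have pq : zprime q by rewrite pr ?mem_head.
have {}IH D' := IH D' (fun r rP => pr r (mem_behead (rP : r \in behead (q :: P)))).
have q1 := nR_gt1 pq; rewrite !big_cons.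
set h := \prod_(j <- P) _ in IH *; set T := \sum_(j <- P) _ in IH *.
set A := subset_sum _ _ D; set B := subset_sum _ _ (D %/ nrm q).
have hA : (h - A) * ln D.+1%:R <= h * T by exact: IH.
have hB : (h - B) * ln (D %/ nrm q).+1%:R <= h * T by exact: IH.
have wP r : r \in P -> 0 <= norm_weight r by move=> _; exact: norm_weight_ge0.
have B0 : 0 <= B by exact: subset_sum_ge0.
have Bh : B <= h by exact: subset_sum_le_prod.
have i0 := norm_weight_ge0 q; have lq : 0 <= ln (nR q) by rewrite ln_ge0 ?ltW.
have L : ln D.+1%:R <= ln (D %/ nrm q).+1%:R + ln (nR q).
  have nq0 : (0 < nrm q)%N by rewrite ltnW ?zprime_nrm.
  rewrite -lnM ?posrE ?ltr0n // ler_ln ?posrE ?mulr_gt0 ?ltr0n // -natrM ler_nat mulnC.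
  exact: divn_succ_bound.
have f2 : (h - B) * ln D.+1%:R <= h * T + (h - B) * ln (nR q).
  apply: le_trans (ler_wpM2l _ L) _; first by rewrite subr_ge0.
  by rewrite mulrDr lerD2r.
have f3 := ler_wpM2l i0 f2.
have f4 : 0 <= norm_weight q * (B * ln (nR q)) by rewrite !mulr_ge0.
have f5 : 0 <= norm_weight q * (norm_weight q * (h * ln (nR q))).
  by rewrite !mulr_ge0 // (le_trans B0).
rewrite -[(nR q)^-1]/(norm_weight q) in f3 f4 f5 *.
move: hA f3 f4 f5; move: (ln D.+1%:R) (ln (nR q)) (norm_weight q) => L1 l i; lra.
Qed.

(** A substitute for Mertens' product theorem. With D = floor(exp(2 T)), where T is the sum on the
    right, [subset_sum_tail] leaves at least half of the product in the subset sum; that sum is at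
    most [recip_sum D], hence at most 8 (1 + 2 T). *)
Lemma prod_norm_weight_le P : nonassoc_primes P ->
  \prod_(q <- P) (1 + norm_weight q) <= 16 * (1 + 2 * \sum_(q <- P) ln (nR q) / nR q).
Proof.
move=> pP; have pr : {in P, forall q, zprime q} by case/nonassoc_primesP: pP.
set T := \sum_(q <- P) _; set h := \prod_(q <- P) _.
have T0 : 0 <= T.
  rewrite /T big_seq sumr_ge0 // => q /pr/nR_gt1 q1.
  by rewrite divr_ge0 ?ler0n // ln_ge0 // ltW.
have h0 : 0 <= h by rewrite prodr_ge0 // => q _; rewrite addr_ge0 ?norm_weight_ge0.
pose D := Num.truncn (expR (2 * T)).
have /andP[D1 D2] : D%:R <= expR (2 * T) < D.+1%:R by apply: truncn_itv; exact: expR_ge0.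
have D0 : (0 < D)%N by rewrite truncn_gt0 -expR0 ler_expR mulr_ge0.
have L1 : 2 * T < ln (D.+1%:R : R) by rewrite -ltr_expR lnK // posrE ltr0n.
have L2 : ln (D%:R : R) <= 2 * T by rewrite -ler_expR lnK // posrE ltr0n.
have := subset_sum_tail D pr; rewrite -/h -/T => tail.
have up : subset_sum norm_weight P D <= 8 * (1 + 2 * T).
  apply: le_trans (smooth_recip_sum_ge D pP) _.
  apply: le_trans (smooth_recip_sum_le_all P D) _.
  by apply: le_trans (recip_sum_le D0) _; lra.
move: tail up; set G := subset_sum _ _ _ => tail up.
rewrite leNgt; apply/negP => big.
have hG : 2 * (h - G) > h by lra.
suff : h * T < (h - G) * ln D.+1%:R by rewrite ltNge tail.
apply: (@le_lt_trans _ _ (2 * (h - G) * T)); first by rewrite ler_wpM2r // ltW.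
have -> : 2 * (h - G) * T = (h - G) * (2 * T) by ring.
by rewrite ltr_pM2l //; lra.
Qed.

Lemma prod_dvd_nrm_le P n : nonassoc_primes P -> n != 0 ->
  (\prod_(q <- P | zdvd q n) nrm q <= nrm n)%N.
Proof.
elim: P n => [|q P IH] n pP n0; first by rewrite big_nil nrm_gt0.
have [pq pP' qP] := nonassoc_cons pP; rewrite big_cons.
case: (boolP (zdvd q n)) => [/zdvdP[m em]|_]; last exact: IH.
have m0 : m != 0 by apply: contraNneq n0 => m0; rewrite em m0 mulr0.
rewrite em nrmM leq_mul2l; apply/orP; right; apply: leq_trans (IH m pP' m0).
rewrite big_seq_cond [X in (_ <= X)%N]big_seq_cond; apply/eq_leq/eq_bigl => r.
have [rP|//] := boolP (r \in P); have [_ rq] := qP r rP.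
by case/nonassoc_primesP: pP' => _ /(_ r rP) pr _; rewrite /= (zprimeM _ _ pr) (negPf rq).
Qed.

Lemma sum_ln_dvd_le P n : nonassoc_primes P -> n != 0 ->
  \sum_(q <- P | zdvd q n) ln (nR q) <= ln (nR n).
Proof.
move=> pP n0; have := prod_dvd_nrm_le pP n0.
have pr : {in P, forall q, zprime q} by case/nonassoc_primesP: pP.
have -> : \sum_(q <- P | zdvd q n) ln (nR q) = ln (\prod_(q <- P | zdvd q n) nrm q)%:R.
  elim: {pP} P pr => [|q P IH] pr; first by rewrite !big_nil ln1.
  have pq : zprime q by rewrite pr ?mem_head.
  have pr' : {in P, forall q, zprime q} by move=> r rP; rewrite pr // inE rP orbT.
  rewrite !big_cons; case: ifP => _; last exact: IH.
  rewrite natrM lnM ?posrE ?ltr0n ?IH //; first by rewrite ltnW ?zprime_nrm.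
  rewrite big_seq_cond prodn_cond_gt0 // => r /andP[rP _].
  by rewrite ltnW ?zprime_nrm ?pr'.
rewrite -(ler_nat R) => le; rewrite ler_ln ?posrE ?ltr0n ?nrm_gt0 //.
by rewrite big_seq_cond prodn_cond_gt0 // => r /andP[/pr/zprime_nrm/ltnW].
Qed.

(** The inequality of [sum_ln_dvd_le] is averaged over n up to w^2 with weights 1 / nrm n. Each q of
    norm at most w keeps all cofactors up to w, which gives T times [recip_sum w] on the left. Both
    reciprocal sums are comparable to 1 + ln w, so one logarithm survives. *)
Lemma sum_ln_norm_le P (w : nat) : nonassoc_primes P -> (0 < w)%N ->
  (forall q, q \in P -> (nrm q <= w)%N) ->
  \sum_(q <- P) ln (nR q) / nR q <= 256 * (1 + ln w%:R).
Proof.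
move=> pP w0 Pw; have pr : {in P, forall q, zprime q} by case/nonassoc_primesP: pP.
set T := \sum_(q <- P) _; set D := (w * w)%N.
have lw : 0 <= ln (w%:R : R) by rewrite ln_ge0 // ler1n.
have lD : ln (D%:R : R) = 2 * ln w%:R by rewrite natrM lnM ?posrE ?ltr0n //; ring.
have D0 : (0 < D)%N by rewrite muln_gt0 w0.
have key : T * recip_sum w <= ln (D%:R : R) * recip_sum D.
  rewrite /recip_sum [leRHS]mulr_sumr.
  apply: le_trans (_ : \sum_(n <- zball D) \sum_(q <- P | zdvd q n) ln (nR q) * (nR n)^-1 <= _);
    last first.
    rewrite big_seq [leRHS]big_seq; apply: ler_sum => n; rewrite mem_zball => /andP[n0 nD].
    rewrite -mulr_suml ler_wpM2r ?invr_ge0 //; apply: le_trans (sum_ln_dvd_le pP _) _.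
      by rewrite -nrm_gt0.
    by rewrite ler_ln ?posrE ?ltr0n // ler_nat.
  rewrite (exchange_big_dep predT) //= /T mulr_suml big_seq [leRHS]big_seq.
  apply: ler_sum => q qP; have q0 := zprime_neq0 (pr _ qP).
  have := @sum_zball_dvd q D predT q0; rewrite /=; under eq_bigl => n do rewrite andbT.
  move=> e.
  rewrite -mulr_sumr e -mulrA ler_wpM2l //; first by rewrite ln_ge0 // ltW ?nR_gt1 ?pr.
  rewrite ler_wpM2l ?invr_ge0 //; apply: ler_sum_sub; rewrite ?uniq_zball // => n.
  rewrite !mem_zball => /andP[-> nw] /=; apply: leq_trans nw _.
  by rewrite leq_divRL ?nrm_gt0 // leq_mul2l Pw ?orbT.
have := recip_sum_ge w0; have := recip_sum_le D0; have := recip_sum_ge1 D0.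
move: key; rewrite lD; set a := recip_sum D; set b := recip_sum w; set l := ln w%:R in lw *.
move=> key a1 a2 b1; have T0 : 0 <= T.
  rewrite /T big_seq sumr_ge0 // => q /pr/nR_gt1 q1.
  by rewrite divr_ge0 ?ler0n // ln_ge0 // ltW.
have l1 : 0 < 1 + l by lra.
rewrite -(ler_pM2r l1).
have h1 : T * ((1 + l) / 8) <= T * b by rewrite ler_wpM2l.
have h2 : 2 * l * a <= 2 * l * (8 * (1 + 2 * l)) by rewrite ler_wpM2l // mulr_ge0.
have h3 : 0 <= l * l by rewrite mulr_ge0.
by lra.
Qed.

(** The threshold 16 = 2^4 together with ln 2 >= 1/2 keeps ln ln Q away from 0, so that bounded
    terms can be absorbed into multiples of it. *)
Lemma lnln_ge (Q : nat) : (16 <= Q)%N -> 2 <= ln (Q%:R : R) /\ 1 / 2 <= ln (ln (Q%:R : R)).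
Proof.
move=> Q16; have l2 : 1 / 2 <= ln (2 : R).
  have := @ln_le_sub1 2^-1; rewrite invr_gt0 ltr0n lnV ?posrE // => /(_ isT); lra.
have h : 2 <= ln (Q%:R : R).
  apply: le_trans (_ : ln (2 ^+ 4) <= _); first by rewrite lnXn //; lra.
  by rewrite ler_ln ?posrE ?exprn_gt0 ?ltr0n ?(leq_trans _ Q16) // -natrX ler_nat.
split => //; apply: le_trans l2 _; rewrite ler_ln ?posrE //; lra.
Qed.

(** The classical N(r) / phi(r) << log log Q. Replacing 1 / (x - 1) by 1 / x costs the exponential
    of twice a sum of 1 / N(q)^2, which is at most 16. In the sum of ln N(q) / N(q), the primes of
    norm above ln Q contribute at most ln N(r) / ln Q <= 2 because they all divide r; the others are
    bounded by [sum_ln_norm_le] at ln Q. *)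
Lemma prod_phi_weight_le (Q : nat) P r : (16 <= Q)%N -> nonassoc_primes P ->
  r != 0 -> (nrm r <= Q ^ 2)%N -> (forall q, q \in P -> zdvd q r) ->
  \prod_(q <- P) (1 + phi_weight q) <= expR 32 * 200 ^+ 2 * ln (ln Q%:R).
Proof.
move=> Q16 pP r0 rQ Pr; have [L2 LL] := lnln_ge Q16.
have pr : {in P, forall q, zprime q} by case/nonassoc_primesP: pP.
set L := ln (Q%:R : R) in L2 LL *; set l := ln L in LL *.
have w0 q : 0 <= norm_weight q by exact: norm_weight_ge0.
have step : \prod_(q <- P) (1 + phi_weight q) <=
    (\prod_(q <- P) (1 + norm_weight q)) * \prod_(q <- P) expR (2 * ((nR q) ^+ 2)^-1).
  rewrite -big_split big_seq [leRHS]big_seq /=; apply: ler_prod => q qP.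
  have q1 := nR_gt1 (pr _ qP); have q2 : 2 <= nR q by rewrite ler_nat zprime_nrm ?pr.
  rewrite addr_ge0 ?phi_weight_ge0 ?pr //=.
  apply: le_trans (_ : (1 + norm_weight q) * (1 + 2 * ((nR q) ^+ 2)^-1) <= _); last first.
    by rewrite ler_wpM2l ?addr_ge0 // expR_ge1Dx.
  rewrite /phi_weight /norm_weight; set x := nR q in q1 q2 *; rewrite -subr_ge0.
  have -> : (1 + x^-1) * (1 + 2 * (x ^+ 2)^-1) - (1 + (x - 1)^-1) =
      (x ^+ 2 - 2) / (x ^+ 3 * (x - 1)) by field; rewrite !lt0r_neq0 //; lra.
  rewrite divr_ge0 // ?mulr_ge0 ?exprn_ge0 //; nra.
apply: le_trans step _; rewrite -expR_sum mulrC -mulrA; apply: ler_pM.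
- exact: expR_ge0.
- by rewrite prodr_ge0 // => q _; rewrite addr_ge0.
- rewrite ler_expR -mulr_sumr; have -> : 32 = 2 * 16 :> R by ring.
  rewrite ler_pM2l //; apply: sum_inv_nrm_sq_le => [|q /pr/zprime_neq0 //].
  by case/nonassoc_primesP: pP.
apply: le_trans (prod_norm_weight_le pP) _.
pose w := Num.truncn L.
have /andP[w1 w2] : w%:R <= L < w.+1%:R by apply: truncn_itv; lra.
have w0' : (0 < w)%N by rewrite truncn_gt0; lra.
have T1 : \sum_(q <- P | (nrm q <= w)%N) ln (nR q) / nR q <= 256 * (1 + l).
  rewrite -big_filter; apply: le_trans (@sum_ln_norm_le _ w _ _ _) _ => //.
  - exact: nonassoc_filter.
  - by move=> q; rewrite mem_filter => /andP[].
  - by rewrite ler_pM2l // lerD2l ler_ln ?posrE ?ltr0n //; lra.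
have T2 : \sum_(q <- P | ~~ (nrm q <= w)%N) ln (nR q) / nR q <= 2.
  apply: le_trans (_ : (\sum_(q <- P) ln (nR q)) / L <= _).
    rewrite mulr_suml big_mkcond big_seq [leRHS]big_seq; apply: ler_sum => q qP.
    have lq : 0 <= ln (nR q) by rewrite ln_ge0 // ltW ?nR_gt1 ?pr.
    case: ifP => [|_]; last by rewrite divr_ge0 //; lra.
    rewrite -ltnNge => wq; rewrite ler_wpM2l // lef_pV2 ?posrE ?ltr0n; last by lra.
      by apply: le_trans (ltW w2) _; rewrite ler_nat.
    by rewrite ltnW ?zprime_nrm ?pr.
  rewrite ler_pdivrMr; last by lra.
  have -> : \sum_(q <- P) ln (nR q) = \sum_(q <- P | zdvd q r) ln (nR q).
    by rewrite big_seq [RHS]big_seq_cond; apply: eq_bigl => q; rewrite andb_idr // => /Pr.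
  apply: le_trans (sum_ln_dvd_le pP r0) _.
  rewrite mulrC mulr_natr -lnXn ?ltr0n ?(leq_trans _ Q16) // ler_ln ?posrE ?ltr0n ?nrm_gt0 //.
    by rewrite -natrX ler_nat.
  by rewrite exprn_gt0 // ltr0n (leq_trans _ Q16).
(* 16 (1 + 2 (256 (1 + l) + 2)) = 8272 + 8192 l is at most 200^2 l, because l >= 1/2. *)
rewrite (bigID (fun q => (nrm q <= w)%N)) /=; lra.
Qed.

End SumsOverGaussianIntegers.

(** * The large sieve *)

Section LargeSieve.
Variable R : realType.
Implicit Types x y d n m p q u v : zi.
Local Notation C := R[i].
Implicit Types z w : C.

Definition sqn z : R := complex.Re z ^+ 2 + complex.Im z ^+ 2.

Lemma cabs_sq z : GI_cabs z ^+ 2 = sqn z.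
Proof. by case: z => a b; rewrite /GI_cabs /= sqr_sqrtr // addr_ge0 ?sqr_ge0. Qed.

Lemma sqn_ge0 z : 0 <= sqn z. Proof. by rewrite addr_ge0 ?sqr_ge0. Qed.
Lemma sqn0 : sqn 0 = 0. Proof. by rewrite /sqn /=; ring. Qed.
Lemma sqnM z w : sqn (z * w) = sqn z * sqn w.
Proof. by case: z w => [a b] [c d]; rewrite /sqn /=; ring. Qed.
Lemma sqnN z : sqn (- z) = sqn z.
Proof. by case: z => [a b]; rewrite /sqn /=; ring. Qed.
Lemma sqnD_le z w : sqn (z + w) <= 2 * (sqn z + sqn w).
Proof.
case: z w => [a b] [c d]; rewrite /sqn /=.
by have := sqr_ge0 (a - c); have := sqr_ge0 (b - d); rewrite !sqrrB !sqrrD; lra.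
Qed.
Lemma sqnB_le z w : sqn (z - w) <= 2 * (sqn z + sqn w).
Proof. by rewrite -(sqnN w) sqnD_le. Qed.
Lemma sqn_eq0 z : (sqn z == 0) = (z == 0).
Proof.
case: z => [a b]; rewrite /sqn /= paddr_eq0 ?sqr_ge0 // !sqrf_eq0 eq_complex /=.
by [].
Qed.
Lemma ReD z w : complex.Re (z + w) = complex.Re z + complex.Re w.
Proof. by case: z w => [a b] [c d]. Qed.
Lemma ImD z w : complex.Im (z + w) = complex.Im z + complex.Im w.
Proof. by case: z w => [a b] [c d]. Qed.
Lemma ReN z : complex.Re (- z) = - complex.Re z. Proof. by case: z. Qed.
Lemma ImN z : complex.Im (- z) = - complex.Im z. Proof. by case: z. Qed.
Lemma Re_sum (I : Type) (s : seq I) (P : pred I) (F : I -> C) :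
  complex.Re (\sum_(i <- s | P i) F i) = \sum_(i <- s | P i) complex.Re (F i).
Proof. exact: (big_morph _ ReD). Qed.
Lemma conj_sum (I : Type) (s : seq I) (F : I -> C) :
  conjc (\sum_(i <- s) F i) = \sum_(i <- s) conjc (F i).
Proof. exact: rmorph_sum. Qed.
Lemma conjM z w : conjc (z * w) = conjc z * conjc w.
Proof. exact: rmorphM. Qed.
Lemma Re_mul_real z (r : R) : complex.Re (z * (r%:C)%C) = complex.Re z * r.
Proof. by case: z => a b /=; rewrite mulr0 subr0. Qed.
Lemma sqn_conj z : sqn (conjc z) = sqn z.
Proof. by case: z => a b; rewrite /sqn /=; ring. Qed.
Lemma mul_conjE z : z * conjc z = ((sqn z)%:C)%C.
Proof. by case: z => a b; apply/eqP; rewrite eq_complex /sqn /=; apply/andP; split; apply/eqP; ring. Qed.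
Lemma sqnE z : sqn z = complex.Re (z * conjc z).
Proof. by rewrite mul_conjE. Qed.
Lemma Re_mul_le z w : 2 * complex.Re (z * w) <= sqn z + sqn w.
Proof.
case: z w => [a b] [c d]; rewrite /sqn /=.
by have := sqr_ge0 (a - c); have := sqr_ge0 (b + d); rewrite !sqrrB !sqrrD; lra.
Qed.

Local Notation e := (@GI_e R).

Lemma eD (s t : R) : e (s + t) = e s * e t.
Proof.
rewrite /GI_e mulrDr cosD sinD; apply/eqP; rewrite eq_complex /=.
by apply/andP; split; apply/eqP; ring.
Qed.
Lemma e0 : e 0 = 1.
Proof. by rewrite /GI_e mulr0 cos0 sin0. Qed.
Lemma eN (t : R) : e (- t) = conjc (e t).
Proof. by rewrite /GI_e mulrN cosN sinN. Qed.
Lemma sqn_e (t : R) : sqn (e t) = 1.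
Proof. by rewrite /sqn /= cos2Dsin2. Qed.
Lemma e1 : e 1 = 1.
Proof. by rewrite /GI_e mulr1 mulrC -[pi * 2]/(pi * 2%:R) mulr_natr cos2pi sin2pi. Qed.
Lemma e_nat (k : nat) : e k%:R = 1.
Proof. by elim: k => [|k IH]; rewrite ?e0 // -natr1 eD IH e1 mulr1. Qed.
Lemma e_int (k : int) : e k%:~R = 1.
Proof.
case: k => k; first exact: e_nat.
by rewrite NegzE mulrNz eN -pmulrn e_nat conjc1.
Qed.

Lemma cos_piquarter_ge : 1 / 2 <= cos (pi / 4 : R).
Proof.
have h : 0 <= cos (pi / 4 : R).
  by apply: cos_ge0_pihalf; have := @pi_gt0 R; lra.
have := cos_mulr2n (pi / 4 : R); have -> : pi / 4 *+ 2 = pi / 2 :> R by rewrite mulr2n; lra.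
by rewrite cos_pihalf; nra.
Qed.

(** A weak Jordan inequality: the mean value theorem with cos >= 1/2 up to pi/4, and beyond that the
    monotonicity of sin with pi/2 < 2. *)
Lemma sin_ge (t : R) : 0 <= t <= pi / 2 -> t / 4 <= sin t.
Proof.
have pi0 := @pi_gt0 R; have pi4 := @pihalf_lt2 R.
have c4 := cos_piquarter_ge.
have half (s : R) : 0 <= s <= pi / 4 -> s / 2 <= sin s.
  move=> /andP[]; rewrite le_eqVlt => /orP[/eqP <- _|s0 s4]; first by rewrite mul0r sin0.
  have der (y : R) : y \in `]0, s[ -> is_derive y 1 sin (cos y) by move=> _; exact: is_derive_sin.
  have [|c] := @MVT R sin cos 0 s s0 der.
    exact/continuous_subspaceT/continuous_sin.
  rewrite in_itv /= subr0 sin0 subr0 => /andP[c0 cs] ->.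
  have : cos (pi / 4) <= cos c by rewrite ltW // ltr_cos ?in_itv /=; lra.
  by nra.
move=> /andP[t0 t2]; have [t4|t4] := leP t (pi / 4).
  by have := half t; rewrite t0 t4 => /(_ isT); lra.
have s4 : 1 / 2 <= sin (pi / 4 : R).
  have := sinDpihalf (- (pi / 4) : R).
  have -> : - (pi / 4) + pi / 2 = pi / 4 :> R by field.
  by rewrite cosN => ->; exact: c4.
have : sin (pi / 4) < sin t.
  by rewrite ltr_sin // in_itv /=; apply/andP; split; lra.
by lra.
Qed.

Lemma sqn_1Be (t : R) : sqn (1 - e t) = 4 * sin (pi * t) ^+ 2.
Proof.
rewrite /sqn /= sub0r sqrrN; have -> : 2 * pi * t = (pi * t) *+ 2 by rewrite mulr2n; ring.
rewrite cos_mulr2n sin_mulr2n !mulr2n; have := cos2Dsin2 (pi * t).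
set c := cos _; set s := sin _ => h.
have c2 : c ^+ 2 = 1 - s ^+ 2 by rewrite -h; ring.
rewrite c2; transitivity (4 * s ^+ 4 + 4 * c ^+ 2 * s ^+ 2); first by ring.
by rewrite c2; ring.
Qed.

Lemma sqn_1Be_ge (t : R) : 0 <= t <= 1 / 2 -> t ^+ 2 <= sqn (1 - e t).
Proof.
move=> /andP[t0 t1]; rewrite sqn_1Be; have pi2 := @pi_ge2 R.
have : pi * t / 4 <= sin (pi * t) by apply: sin_ge; apply/andP; split; nra.
move=> h; have h1 : t / 2 <= sin (pi * t) by nra.
by nra.
Qed.
End LargeSieve.

(** * The dual inequality with Fejer weights *)

Section DualLargeSieve.
Variable R : realType.
Implicit Types x y d n m p q u v : zi.
Local Notation C := R[i].
Local Notation e := (@GI_e R).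
Implicit Types (z w : C) (t : R).

(** The additive character e(Re(n w)), written in coordinates so that the kernels factor into a real
    and an imaginary direction. *)
Definition chi w n : C := e (n.1%:~R * complex.Re w - n.2%:~R * complex.Im w).

Lemma chi_add w n m : chi w (n + m) = chi w n * chi w m.
Proof.
by rewrite /chi -eD zi_addE /= !rmorphD /=; congr e; ring.
Qed.

Lemma chi_addl w z n : chi (w + z) n = chi w n * chi z n.
Proof. by rewrite /chi -eD ReD ImD; congr e; ring. Qed.

Lemma chi_oppl w n : chi (- w) n = conjc (chi w n).
Proof. by rewrite /chi -eN ReN ImN; congr e; ring. Qed.

Lemma sqn_chi w n : sqn (chi w n) = 1. Proof. exact: sqn_e. Qed.

Definition dirichlet_kernel (L : nat) t : C := \sum_(k <- iota 0 L) e (k%:R * t).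

(** With multiplicity: a occurs L - |a| times for |a| < L, which is the Fejer weight. *)
Definition differences (L : nat) : seq int :=
  [seq (k%:Z - l%:Z) | k <- iota 0 L, l <- iota 0 L].

Lemma sum_differences_e L t :
  \sum_(a <- differences L) e (a%:~R * t) = ((sqn (dirichlet_kernel L t))%:C)%C.
Proof.
rewrite -mul_conjE /dirichlet_kernel big_allpairs_dep conj_sum mulr_suml.
apply: eq_bigr => k _; rewrite mulr_sumr; apply: eq_bigr => l _.
by rewrite -eN -eD rmorphB /= mulrBl.
Qed.

(** Every a in [0, M) is k - l with k < 2 M for each of the M values l < M. Thus the Fejer weights
    of length 2 M majorise M times the indicator of [0, M). *)
Lemma sum_differences_ge (f : int -> R) (M : nat) : (forall a, 0 <= f a) ->
  M%:R * \sum_(a <- iota 0 M) f a%:Z <= \sum_(a <- differences (2 * M)) f a.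
Proof.
move=> f0; rewrite big_allpairs_dep exchange_big /=.
rewrite mulSn mul1n iotaD big_cat /=.
apply: ler_wpDr; first by rewrite sumr_ge0 // => l _; rewrite sumr_ge0.
have -> : M%:R * \sum_(a <- iota 0 M) f a%:Z = \sum_(l <- iota 0 M) \sum_(a <- iota 0 M) f a%:Z.
  by rewrite big_const_seq count_predT size_iota iter_addr_0 mulr_natl.
rewrite big_seq [leRHS]big_seq; apply: ler_sum => l; rewrite mem_iota add0n => /andP[_ lM].
have -> : iota 0 M ++ iota M M = iota 0 l ++ iota l M ++ iota (l + M) (M - l).
  by rewrite -!iotaD; congr iota; lia.
rewrite !big_cat /=; apply: ler_wpDl; first by rewrite sumr_ge0.
apply: ler_wpDr; first by rewrite sumr_ge0.
have -> : iota l M = [seq (l + a)%N | a <- iota 0 M] by rewrite -iotaDl addn0.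
rewrite big_map le_eqVlt; apply/orP; left; apply/eqP.
by apply: eq_bigr => a _; congr f; lia.
Qed.

Lemma sum_box_ge (f : int -> int -> R) (M : nat) : (forall a b, 0 <= f a b) ->
  M%:R ^+ 2 * \sum_(a <- iota 0 M) \sum_(b <- iota 0 M) f a%:Z b%:Z <=
  \sum_(a <- differences (2 * M)) \sum_(b <- differences (2 * M)) f a b.
Proof.
move=> f0; have h (a : int) : 0 <= \sum_(b <- differences (2 * M)) f a b by rewrite sumr_ge0.
apply: le_trans (@sum_differences_ge (fun a => _) M h).
rewrite expr2 -mulrA ler_wpM2l // mulr_sumr; apply: ler_sum => a _.
exact: sum_differences_ge.
Qed.

Lemma sqn_sum (I : Type) (s : seq I) (F : I -> C) :
  sqn (\sum_(i <- s) F i) = complex.Re (\sum_(i <- s) \sum_(j <- s) F i * conjc (F j)).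
Proof.
rewrite sqnE conj_sum mulr_suml; congr complex.Re.
by apply: eq_bigr => i _; rewrite mulr_sumr.
Qed.

Definition fejer_kernel (L : nat) w : R :=
  sqn (dirichlet_kernel L (complex.Re w)) * sqn (dirichlet_kernel L (- complex.Im w)).

Lemma fejer_kernelE L w :
  \sum_(a <- differences L) \sum_(b <- differences L) chi w (a, b) =
  ((fejer_kernel L w)%:C)%C.
Proof.
rewrite /fejer_kernel rmorphM /= -!sum_differences_e mulr_suml; apply: eq_bigr => a _.
by rewrite mulr_sumr; apply: eq_bigr => b _; rewrite -eD /chi /=; congr e; ring.
Qed.

Lemma dirichlet_kernelN L t : dirichlet_kernel L (- t) = conjc (dirichlet_kernel L t).
Proof.
by rewrite /dirichlet_kernel conj_sum; apply: eq_bigr => k _; rewrite mulrN eN.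
Qed.

Lemma fejer_kernelN L w : fejer_kernel L (- w) = fejer_kernel L w.
Proof. by rewrite /fejer_kernel ReN ImN !dirichlet_kernelN !sqn_conj. Qed.

Lemma fejer_kernel_ge0 L w : 0 <= fejer_kernel L w.
Proof. by rewrite mulr_ge0 ?sqn_ge0. Qed.

(** The sharp box is majorised by Fejer weights and the square is expanded. A Schur test then needs
    row sums only, because [fejer_kernel] is nonnegative and even. *)
Lemma dual_box_bound (I : Type) (s : seq I) (x : I -> C) (b : I -> C) (M : nat) (B : R) :
  (forall i, \sum_(j <- s) fejer_kernel (2 * M) (x j - x i) <= B) ->
  M%:R ^+ 2 * \sum_(k <- iota 0 M) \sum_(l <- iota 0 M)
     sqn (\sum_(j <- s) b j * chi (x j) (k%:Z, l%:Z)) <=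
  B * \sum_(j <- s) sqn (b j).
Proof.
move=> rowB; pose f k l := sqn (\sum_(j <- s) b j * chi (x j) (k, l)).
apply: le_trans (@sum_box_ge f M _) _; first by move=> k l; exact: sqn_ge0.
set D := differences _.
have -> : \sum_(a <- D) \sum_(c <- D) f a c =
    \sum_(i <- s) \sum_(j <- s) complex.Re (b i * conjc (b j)) * fejer_kernel (2 * M) (x i - x j).
  transitivity (complex.Re (\sum_(a <- D) \sum_(c <- D) \sum_(i <- s) \sum_(j <- s)
      b i * conjc (b j) * chi (x i - x j) (a, c))).
    rewrite Re_sum; apply: eq_bigr => a _; rewrite Re_sum; apply: eq_bigr => c _.
    rewrite /f sqn_sum; congr complex.Re; apply: eq_bigr => i _; apply: eq_bigr => j _.
    by rewrite conjM chi_addl chi_oppl; ring.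
  under eq_bigr => a _ do (rewrite exchange_big /=; under eq_bigr => i _ do rewrite exchange_big /=).
  rewrite exchange_big Re_sum /=; apply: eq_bigr => i _.
  rewrite exchange_big Re_sum /=; apply: eq_bigr => j _.
  under eq_bigr => a _ do rewrite -mulr_sumr.
  rewrite -mulr_sumr fejer_kernelE.
  exact: Re_mul_real.
pose g i j := sqn (b i) * fejer_kernel (2 * M) (x j - x i).
apply: le_trans (_ : 2^-1 * (\sum_(i <- s) \sum_(j <- s) g i j + \sum_(i <- s) \sum_(j <- s) g j i) <= _).
  rewrite -big_split mulr_sumr /=; apply: ler_sum => i _.
  rewrite -big_split mulr_sumr /=; apply: ler_sum => j _.
  rewrite /g -[x j - x i]opprB fejer_kernelN -mulrDl [leRHS]mulrA ler_wpM2r ?fejer_kernel_ge0 //.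
  by have := Re_mul_le (b i) (conjc (b j)); rewrite sqn_conj; lra.
rewrite [X in _ + X]exchange_big /=.
have -> (X : R) : 2^-1 * (X + X) = X by field.
rewrite mulr_sumr; apply: ler_sum => i _.
by rewrite -mulr_sumr mulrC ler_wpM2r ?sqn_ge0.
Qed.

(** The dual bound is tested at the conjugates of the sums S j. In place of Cauchy-Schwarz, 2 Re(c
    V) <= B |c|^2 + |V|^2 / B yields two copies of the left side, one of which the dual bound
    absorbs. *)
Lemma duality (I J : Type) (s : seq I) (s' : seq J) (A : I -> J -> C) (c : J -> C) (B : R) :
  0 < B ->
  (forall b : I -> C, \sum_(n <- s') sqn (\sum_(j <- s) b j * A j n) <= B * \sum_(j <- s) sqn (b j)) ->
  \sum_(j <- s) sqn (\sum_(n <- s') c n * A j n) <= B * \sum_(n <- s') sqn (c n).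
Proof.
move=> B0 dual; pose S j := \sum_(n <- s') c n * A j n.
pose V (n : J) := \sum_(j <- s) conjc (S j) * A j n.
have VB : \sum_(n <- s') sqn (V n) <= B * \sum_(j <- s) sqn (S j).
  apply: le_trans (dual (fun j => conjc (S j))) _.
  by under eq_bigr => j _ do rewrite sqn_conj.
have E : \sum_(j <- s) sqn (S j) = complex.Re (\sum_(n <- s') c n * V n).
  under eq_bigr => j _ do rewrite sqnE.
  rewrite -Re_sum; congr complex.Re; under [RHS]eq_bigr => n _ do rewrite mulr_sumr.
  rewrite exchange_big /=; apply: eq_bigr => j _.
  by rewrite /S mulr_suml; apply: eq_bigr => n _; ring.
have : 2 * \sum_(j <- s) sqn (S j) <= B * \sum_(n <- s') sqn (c n) + B^-1 * \sum_(n <- s') sqn (V n).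
  rewrite E Re_sum !mulr_sumr -big_split; apply: ler_sum => n _ /=.
  have h0 : 0 < Num.sqrt B by rewrite sqrtr_gt0.
  have hB : Num.sqrt B ^+ 2 = B by rewrite sqr_sqrtr // ltW.
  set r := Num.sqrt B in h0 hB.
  have := Re_mul_le ((r%:C)%C * c n) ((r^-1%:C)%C * V n).
  have sq (y : R) : sqn ((y%:C)%C) = y ^+ 2 by rewrite /sqn /=; ring.
  rewrite !sqnM !sq exprVn hB.
  have -> // : ((r%:C)%C * c n) * ((r^-1%:C)%C * V n) = c n * V n.
  have -> : ((r%:C)%C * c n) * ((r^-1%:C)%C * V n) = ((r%:C)%C * (r^-1%:C)%C) * (c n * V n) by ring.
  by rewrite -rmorphM /= divff ?lt0r_neq0 // mul1r.
have : B^-1 * \sum_(n <- s') sqn (V n) <= \sum_(j <- s) sqn (S j).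
  by rewrite mulrC ler_pdivrMr // mulrC.
by rewrite /S; lra.
Qed.

Lemma sqn_kernel_le L t : sqn (dirichlet_kernel L t) <= L%:R ^+ 2.
Proof.
rewrite sqn_sum Re_sum expr2.
have -> : L%:R * L%:R = \sum_(k <- iota 0 L) \sum_(l <- iota 0 L) (1 : R).
  by rewrite !big_const_seq !count_predT size_iota !iter_addr_0 mulr_natl.
apply: ler_sum => k _; rewrite Re_sum; apply: ler_sum => l _.
have := Re_mul_le (e (k%:R * t)) (conjc (e (l%:R * t))).
by rewrite sqn_conj !sqn_e; lra.
Qed.

Lemma sqn_kernel_1Be L t : sqn (1 - e t) * sqn (dirichlet_kernel L t) <= 4.
Proof.
rewrite -sqnM; have -> : (1 - e t) * dirichlet_kernel L t = 1 - e (L%:R * t).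
  elim: L => [|L IH]; first by rewrite /dirichlet_kernel big_nil mul0r e0; ring.
  rewrite /dirichlet_kernel -addn1 iotaD big_cat big_seq1 add0n mulrDr IH.
  have -> : (L + 1)%:R * t = L%:R * t + t by rewrite natrD; ring.
  by rewrite eD; ring.
by apply: le_trans (sqnB_le _ _) _; rewrite sqn_e /sqn /=; lra.
Qed.

(** Combines |K|^2 <= L^2 with |K|^2 |1 - e(t)|^2 <= 4. The distance from t to 0 is at least u / L,
    that to 1 at least (L - u - 1) / L, and the nearer end supplies the bound: 1 + 4 = 5 <= 8. *)
Lemma kernel_bin_le L (u : nat) t : 0 <= t < 1 -> (u < L)%N ->
  u%:R <= L%:R * t < u.+1%:R ->
  sqn (dirichlet_kernel L t) <=
    8 * L%:R ^+ 2 * ((1 + u%:R ^+ 2)^-1 + (1 + (L - u.+1)%:R ^+ 2)^-1).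
Proof.
move=> /andP[t0 t1] uL /andP[u1 u2].
have L0 : (0 : R) < L%:R by rewrite ltr0n (leq_ltn_trans _ uL).
have pos (k : nat) : 0 < 1 + k%:R ^+ 2 :> R by rewrite ltr_wpDr ?sqr_ge0.
have key (k : nat) (r : R) : k%:R <= L%:R * r -> 0 <= r -> r ^+ 2 <= sqn (1 - e t) ->
    sqn (dirichlet_kernel L t) <= 8 * L%:R ^+ 2 * (1 + k%:R ^+ 2)^-1.
  move=> kr r0 re; rewrite ler_pdivlMr //.
  have h1 := sqn_kernel_le L t; have h2 := sqn_kernel_1Be L t.
  move: h1 h2; set D := sqn (dirichlet_kernel _ _) => h1 h2.
  have D0 : 0 <= D by exact: sqn_ge0.
  have h3 : D * k%:R ^+ 2 <= D * (L%:R ^+ 2 * sqn (1 - e t)).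
    rewrite ler_wpM2l //; apply: le_trans (_ : (L%:R * r) ^+ 2 <= _).
      by rewrite lerXn2r ?nnegrE ?mulr_ge0 // ltW.
    by rewrite exprMn ler_wpM2l ?sqr_ge0.
  have h4 : L%:R ^+ 2 * (sqn (1 - e t) * D) <= L%:R ^+ 2 * 4.
    by rewrite ler_wpM2l ?sqr_ge0.
  by have := sqr_ge0 (L%:R : R); lra.
have split (X Y Z W : R) : 0 <= W -> 0 <= Z -> Y <= X * Z -> 0 <= X -> Y <= X * (Z + W).
  by move=> W0 Z0 h X0; rewrite mulrDr (le_trans h) // lerDl mulr_ge0.
have X0 : 0 <= 8 * L%:R ^+ 2 :> R by rewrite mulr_ge0 ?sqr_ge0.
have [th|th] := leP t (1 / 2).
  apply: split (key u t _ _ _) _ => //; rewrite ?invr_ge0 ?(ltW (pos _)) //.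
  by apply: sqn_1Be_ge; rewrite t0.
rewrite [X in _ * X]addrC; apply: split (key (L - u.+1)%N (1 - t) _ _ _) _ => //;
  rewrite ?invr_ge0 ?(ltW (pos _)) //.
- by rewrite natrB // mulrBr mulr1; lra.
- lra.
have -> : sqn (1 - e t) = sqn (1 - e (1 - t)).
  by rewrite eD e1 mul1r eN -[X in X - conjc _]conjc1 -rmorphB sqn_conj.
by apply: sqn_1Be_ge; lra.
Qed.

Lemma kernel_frac L t : dirichlet_kernel L t = dirichlet_kernel L (t - (Num.floor t)%:~R).
Proof.
apply: eq_bigr => k _; rewrite mulrBr eD eN.
by rewrite -[k%:R]/((k%:Z)%:~R) -intrM e_int conjc1 mulr1.
Qed.

Definition bin (L : nat) t : nat := Num.truncn (L%:R * (t - (Num.floor t)%:~R)).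

Lemma frac_bound t : 0 <= t - (Num.floor t)%:~R < 1.
Proof.
have /andP[h1 h2] := Num.Theory.floor_itv t; rewrite intrD in h2.
by apply/andP; split; lra.
Qed.

Lemma bin_lt L t : (0 < L)%N -> (bin L t < L)%N.
Proof.
move=> L0; have /andP[h1 h2] := frac_bound t; have L0' : (0 : R) < L%:R by rewrite ltr0n.
rewrite truncn_lt_nat ?mulr_ge0 // ?ltW //.
by rewrite gtr_pMr.
Qed.

Lemma kernel_bin L t : (0 < L)%N -> sqn (dirichlet_kernel L t) <=
  8 * L%:R ^+ 2 * ((1 + (bin L t)%:R ^+ 2)^-1 + (1 + (L - (bin L t).+1)%:R ^+ 2)^-1).
Proof.
move=> L0; rewrite kernel_frac; apply: kernel_bin_le; first exact: frac_bound.
  exact: bin_lt.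
by apply: truncn_itv; rewrite mulr_ge0 //; case/andP: (frac_bound t).
Qed.

End DualLargeSieve.

(** * The large sieve inequality for points in the plane modulo Z[i] *)

Section LargeSieveInequality.
Variable R : realType.
Implicit Types x y d n m p q u v : zi.
Local Notation C := R[i].
Implicit Types (z w : C) (t : R).

Definition frac_part t : R := t - (Num.floor t)%:~R.

Lemma frac_itv t : 0 <= frac_part t < 1.
Proof. exact: frac_bound. Qed.

Lemma frac_sub t (r : R) : 0 <= r <= frac_part t -> frac_part (t - r) = frac_part t - r.
Proof.
move=> /andP[r0 rt]; have /andP[f0 f1] := frac_itv t; rewrite /frac_part.
suff -> : Num.floor (t - r) = Num.floor t by ring.
apply: floor_def; rewrite intrD; move: rt f1; rewrite /frac_part => rt f1.
by apply/andP; split; lra.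
Qed.

Lemma frac_bin (L u : nat) t : (0 < L)%N -> bin L t = u -> frac_part (t - u%:R / L%:R) < L%:R^-1.
Proof.
move=> L0 <-; have L0' : (0 : R) < L%:R by rewrite ltr0n.
have /andP[f0 f1] := frac_itv t.
have /andP[b1 b2] : (bin L t)%:R <= L%:R * frac_part t < (bin L t).+1%:R.
  by apply: truncn_itv; rewrite mulr_ge0.
rewrite frac_sub; first by rewrite ltrBlDr -[X in X + _]mul1r -mulrDl ltr_pdivlMr // mulrC addrC natr1.
by rewrite divr_ge0 //= ler_pdivrMr // mulrC.
Qed.

Lemma ler_sum_mem (I : eqType) (s : seq I) (i : I) (F : I -> R) :
  i \in s -> (forall j, 0 <= F j) -> F i <= \sum_(j <- s) F j.
Proof. by move=> si F0; rewrite (big_rem i si) /= lerDl sumr_ge0. Qed.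

Lemma bin_sum_le (I : Type) (s : seq I) (b1 b2 : I -> nat) (F : nat -> R) (L K : nat) :
  (forall k, 0 <= F k) -> (forall i, (b1 i < L)%N /\ (b2 i < L)%N) ->
  (forall k l, (count (fun i => (b1 i == k) && (b2 i == l)) s <= K)%N) ->
  \sum_(i <- s) F (b1 i) * F (b2 i) <= K%:R * (\sum_(k <- iota 0 L) F k) ^+ 2.
Proof.
move=> F0 bL cK.
apply: le_trans (_ : \sum_(i <- s) \sum_(k <- iota 0 L) \sum_(l <- iota 0 L)
    ((b1 i == k) && (b2 i == l))%:R * (F k * F l) <= _).
  apply: ler_sum => i _; have [h1 h2] := bL i.
  have pos k l : 0 <= ((b1 i == k) && (b2 i == l))%:R * (F k * F l) by rewrite !mulr_ge0.
  apply: le_trans (@ler_sum_mem _ (iota 0 L) (b1 i) _ _ _); last first.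
  - by move=> k; rewrite sumr_ge0.
  - by rewrite mem_iota.
  apply: le_trans (@ler_sum_mem _ (iota 0 L) (b2 i) _ _ _); last first.
  - by move=> k; exact: pos.
  - by rewrite mem_iota.
  by rewrite !eqxx mul1r.
rewrite exchange_big expr2 mulr_suml mulr_sumr /=; apply: ler_sum => k _.
rewrite exchange_big mulr_sumr mulr_sumr /=; apply: ler_sum => l _.
rewrite -mulr_suml ler_wpM2r ?mulr_ge0 // -natr_sum ler_nat.
apply: leq_trans (cK k l); rewrite -sum1_count [leqRHS]big_mkcond /=.
by apply: leq_sum => i _; case: (_ && _).
Qed.

Lemma sum_inv_1Dsq_le (L : nat) : \sum_(k <- iota 0 L) (1 + (k%:R : R) ^+ 2)^-1 <= 3.
Proof.
case: L => [|L]; first by rewrite big_nil.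
rewrite /= big_cons expr0n /= addr0 invr1.
suff : \sum_(j <- iota 1 L) (1 + (j%:R : R) ^+ 2)^-1 <= 2 by lra.
apply: le_trans (@sum_inv_sq_le R L); rewrite /index_iota subn1 /=.
rewrite big_seq [leRHS]big_seq; apply: ler_sum => j; rewrite mem_iota => /andP[j0 _].
by rewrite lef_pV2 ?posrE ?ltr_wpDr ?exprn_gt0 ?sqr_ge0 ?ltr0n // lerDr.
Qed.

(** Here [w] is the lower left corner of a half-open square of side 1 / L, taken modulo Z[i]. *)
Definition in_bin (L : nat) w z : bool :=
  (frac_part (complex.Re (z - w)) < L%:R^-1) && (frac_part (complex.Im (z - w)) < L%:R^-1).

(** Seen from [z], the torus splits into L^2 cells with at most [K] points each, and the kernel
    bound is a product over the two cell indices. In each direction it sums to at most 8 L^2 (3 + 3)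
    = 48 L^2. *)
Lemma fejer_row_sum (I : Type) (s : seq I) (x : I -> C) (L K : nat) z : (0 < L)%N ->
  (forall w, (count (fun i => in_bin L w (x i)) s <= K)%N) ->
  \sum_(j <- s) fejer_kernel L (x j - z) <= K%:R * (48 * L%:R ^+ 2) ^+ 2.
Proof.
move=> L0 hK.
pose F (k : nat) : R := 8 * L%:R ^+ 2 * ((1 + k%:R ^+ 2)^-1 + (1 + (L - k.+1)%:R ^+ 2)^-1).
have pos (k : nat) : 0 <= (1 + k%:R ^+ 2)^-1 :> R by rewrite invr_ge0 addr_ge0 ?sqr_ge0.
have F0 k : 0 <= F k by rewrite !mulr_ge0 ?sqr_ge0 ?addr_ge0.
pose b1 i := bin L (complex.Re (x i - z)); pose b2 i := bin L (complex.Im (x i - z)).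
apply: le_trans (_ : \sum_(j <- s) F (b1 j) * F (b2 j) <= _).
  apply: ler_sum => j _; rewrite /fejer_kernel dirichlet_kernelN sqn_conj.
  by rewrite ler_pM ?sqn_ge0 ?kernel_bin.
apply: le_trans (_ : K%:R * (\sum_(k <- iota 0 L) F k) ^+ 2 <= _).
  apply: bin_sum_le => // [i|k l]; first by rewrite !bin_lt.
  pose w : C := z + Complex (k%:R / L%:R) (l%:R / L%:R).
  apply: leq_trans (hK w); apply: sub_count => i /andP[/eqP e1 /eqP e2]; rewrite /in_bin.
  have -> : complex.Re (x i - w) = complex.Re (x i - z) - k%:R / L%:R.
    by rewrite /w; case: (x i) (z) => [a b] [c d] /=; ring.
  have -> : complex.Im (x i - w) = complex.Im (x i - z) - l%:R / L%:R.
    by rewrite /w; case: (x i) (z) => [a b] [c d] /=; ring.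
  by apply/andP; split; apply: frac_bin.
rewrite ler_wpM2l // lerXn2r ?nnegrE ?sumr_ge0 ?mulr_ge0 ?sqr_ge0 //.
rewrite -mulr_sumr big_split /=.
have -> : \sum_(k <- iota 0 L) (1 + (L - k.+1)%:R ^+ 2)^-1 = \sum_(k <- iota 0 L) (1 + k%:R ^+ 2)^-1 :> R.
  have -> : iota 0 L = index_iota 0 L by rewrite /index_iota subn0.
  by rewrite [RHS]big_nat_rev.
have h := sum_inv_1Dsq_le L; have h2 := sqr_ge0 (L%:R : R).
have -> : 48 * L%:R ^+ 2 = 8 * L%:R ^+ 2 * 6 :> R by ring.
rewrite ler_wpM2l ?mulr_ge0 //; lra.
Qed.

(** Row sums for length 2 M are at most K (48 (2 M)^2)^2 = 192^2 K M^4, and the box inequality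
    divides by M^2. In the dual form the corner [n0] only multiplies the coefficients by numbers of
    modulus one. *)
Theorem large_sieve (I : Type) (s : seq I) (x : I -> C) (M K : nat) (n0 : zi)
    (supp : seq zi) (c : zi -> C) : (0 < M)%N -> (0 < K)%N -> uniq supp ->
  (forall n, n \in supp -> exists k l : nat, [/\ (k < M)%N, (l < M)%N & n = n0 + (k%:Z, l%:Z)]) ->
  (forall w, (count (fun i => in_bin (2 * M) w (x i)) s <= K)%N) ->
  \sum_(i <- s) sqn (\sum_(n <- supp) c n * chi (x i) n) <=
  192 ^+ 2 * K%:R * M%:R ^+ 2 * \sum_(n <- supp) sqn (c n).
Proof.
move=> M0 K0 us hs hK; have M0' : (0 : R) < M%:R by rewrite ltr0n.
apply: duality => [|b]; first by rewrite !mulr_gt0 ?ltr0n ?exprn_gt0.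
pose box : seq zi := [seq (k%:Z, l%:Z) | k <- iota 0 M, l <- iota 0 M].
have ubox : uniq [seq n0 + m | m <- box].
  rewrite map_inj_uniq; last exact: addrI.
  by apply: allpairs_uniq; rewrite ?iota_uniq // => -[k l] [k' l'] _ _ /= [-> ->].
apply: le_trans (_ : \sum_(n <- [seq n0 + m | m <- box]) sqn (\sum_(j <- s) b j * chi (x j) n) <= _).
  apply: ler_sum_sub => // [n /hs[k [l [kM lM ->]]]|n _]; last exact: sqn_ge0.
  apply: map_f; apply/allpairsP; exists (k, l); split; rewrite ?mem_iota //.
rewrite big_map big_allpairs_dep /=.
pose b' j := b j * chi (x j) n0.
have := @dual_box_bound R I s x b' M _ (fun i => fejer_row_sum (x i) _ hK).
rewrite muln_gt0 M0 => /(_ isT).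
have -> : \sum_(j <- s) sqn (b' j) = \sum_(j <- s) sqn (b j).
  by apply: eq_bigr => j _; rewrite sqnM sqn_chi mulr1.
set S := \sum_(j <- s) sqn (b j).
under eq_bigr => k _ do under eq_bigr => l _ do
  under eq_bigr => j _ do rewrite chi_add mulrA.
set T := \sum_(k <- iota 0 M) _ => h.
rewrite -(ler_pM2l (exprn_gt0 2 M0')); apply: le_trans h _.
rewrite natrM le_eqVlt; apply/orP; left; apply/eqP; ring.
Qed.

End LargeSieveInequality.

(** * The sieve *)

Section Sieve.
Variable R : realType.
Implicit Types x y d n m p q u v : zi.
Local Notation C := R[i].
Local Notation e := (@GI_e R).
Local Notation nR q := ((nrm q)%:R : R).
Local Notation toC := (@GI_gtoC R).
Implicit Types (z w : C) (t : R).

(** * Characters at fractions *)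

Lemma toCD x y : toC (x + y) = toC x + toC y.
Proof. by apply/eqP; rewrite eq_complex /= !rmorphD /= !eqxx. Qed.
Lemma toCB x y : toC (x - y) = toC x - toC y.
Proof. by apply/eqP; rewrite eq_complex /= !rmorphB /= !eqxx. Qed.
Lemma toCM x y : toC (x * y) = toC x * toC y.
Proof. by apply/eqP; rewrite eq_complex /= !(rmorphB, rmorphD, rmorphM) /= !eqxx. Qed.
Lemma sqn_toC x : sqn (toC x) = nR x.
Proof. by rewrite /sqn /= -!rmorphXn -rmorphD /= -nrmE. Qed.
Lemma toC0 : toC 0 = 0. Proof. by apply/eqP; rewrite eq_complex /= !eqxx. Qed.
Lemma toC_eq0 x : (toC x == 0) = (x == 0).
Proof. by rewrite -sqn_eq0 sqn_toC pnatr_eq0 nrm_eq0. Qed.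
Lemma toC_inj x y : toC x = toC y -> x = y.
Proof. by move=> /eqP; rewrite -subr_eq0 -toCB toC_eq0 subr_eq0 => /eqP. Qed.

Lemma chi_Re w n : chi w n = e (complex.Re (toC n * w)).
Proof. by case: w => a b. Qed.

Lemma chi_toC k n : chi (toC k) n = 1.
Proof. by rewrite chi_Re -toCM e_int. Qed.

Lemma chi0 n : chi (0 : C) n = 1.
Proof. exact: chi_toC 0 n. Qed.

Lemma chi_sub w n m : chi w (n - m) = chi w n * conjc (chi w m).
Proof.
rewrite chi_add; congr (_ * _); rewrite /chi -eN; congr e.
by rewrite /= !rmorphN /=; ring.
Qed.

Lemma e_eq1 t : e t = 1 -> exists k : int, t = k%:~R.
Proof.
move=> e1t; exists (Num.floor t); have /andP[f0 f1] := frac_itv t.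
suff : frac_part t = 0 by move/eqP; rewrite subr_eq0 => /eqP.
have ef : e (frac_part t) = 1 by rewrite /frac_part eD eN e_int conjc1 mulr1.
have [h|h] := leP (frac_part t) (1 / 2).
  have := @sqn_1Be_ge R (frac_part t); rewrite f0 h => /(_ isT).
  by rewrite ef subrr sqn0 => h2; apply/eqP; rewrite -sqrf_eq0 eq_le h2 sqr_ge0.
have := @sqn_1Be_ge R (1 - frac_part t); have -> : 0 <= 1 - frac_part t <= 1 / 2 by lra.
move=> /(_ isT); rewrite eD eN e1 ef conjc1 mul1r subrr sqn0 => h2.
have : (1 - frac_part t) ^+ 2 == 0 by rewrite eq_le h2 sqr_ge0.
by rewrite sqrf_eq0 subr_eq0 => /eqP h3; rewrite -h3 ltxx in f1.
Qed.

Lemma chi_eq1 w : (forall n, chi w n = 1) -> exists k, w = toC k.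
Proof.
move=> h; have [a ea] := e_eq1 (h ((1, 0) : zi)); have [b eb] := e_eq1 (h ((0, -1) : zi)).
exists (a, b); case: w ea eb h => u v /=; rewrite mulr0z mulr1z mulrN1z => ea eb _.
by apply/eqP; rewrite eq_complex /= -ea -eb; apply/andP; split; apply/eqP; ring.
Qed.

Definition cfrac (a d : zi) : C := toC a / toC d.

Lemma chi_frac_mod q b b' n : q != 0 -> zdvd q (b - b') ->
  chi (cfrac b q) n = chi (cfrac b' q) n.
Proof.
move=> q0 /zdvdP[k e1]; have -> : b = b' + q * k by rewrite -e1; ring.
have q0' : toC q != 0 by rewrite toC_eq0.
have -> : cfrac (b' + q * k) q = cfrac b' q + toC k.
  by rewrite /cfrac toCD toCM; field.
by rewrite chi_addl chi_toC mulr1.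
Qed.

Lemma chi_frac_add q b b' n : chi (cfrac (b + b') q) n = chi (cfrac b q) n * chi (cfrac b' q) n.
Proof. by rewrite -chi_addl /cfrac toCD mulrDl. Qed.

(** Re(b m / q) is symmetric in b and m, so if all these characters were 1 at m, then m / q would be
    a Gaussian integer. Translation by a suitable b0 thus multiplies the sum by a factor other than
    1. *)
Lemma sum_zres_chi q m : q != 0 -> ~~ zdvd q m ->
  \sum_(b <- zres q) chi (cfrac b q) m = 0.
Proof.
move=> q0 qm; have q0' : toC q != 0 by rewrite toC_eq0.
have sym b : chi (cfrac b q) m = chi (cfrac m q) b.
  by rewrite !chi_Re; congr (e (complex.Re _)); rewrite /cfrac; ring.
have [b0 b0m] : exists b0, chi (cfrac b0 q) m != 1.
  apply: contrapT => /forallNP h; case/negP: qm.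
  have [n|k ek] := @chi_eq1 (cfrac m q).
    by rewrite -sym; apply/eqP/negPn/negP/h.
  apply/zdvdP; exists k; apply: toC_inj; rewrite toCM -ek /cfrac; by field.
set T := \sum_(b <- zres q) _.
suff : T = T * chi (cfrac b0 q) m.
  move/eqP; rewrite -subr_eq0 -{1}[T]mulr1 -mulrBr mulf_eq0 subr_eq0 [1 == _]eq_sym (negPf b0m).
  by rewrite orbF => /eqP.
rewrite {1}/T (perm_big _ (perm_zres_shift b0 q0)) big_map mulr_suml; apply: eq_bigr => b _.
rewrite -chi_frac_add; apply: chi_frac_mod => //.
by rewrite -opprB zdvdN zrem_dvd.
Qed.

Definition zres_star q : seq zi := [seq b <- zres q | b != 0].

Lemma sum_zres_star_chi q m : q != 0 -> ~~ zdvd q m ->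
  \sum_(b <- zres_star q) chi (cfrac b q) m = -1.
Proof.
move=> q0 qm; have := sum_zres_chi q0 qm.
rewrite (bigID (fun b => b != 0)) /= -big_filter -/(zres_star q) => /eqP.
rewrite addr_eq0 => /eqP ->; congr (- _).
rewrite -big_filter; have -> : [seq b <- zres q | ~~ (b != 0)] = [:: 0].
  apply: perm_small_eq => //; apply: uniq_perm => //; first exact/filter_uniq/uniq_zres.
  move=> b; rewrite mem_filter negbK inE; case: eqP => //= ->.
  exact: zres0.
by rewrite big_seq1 /cfrac toC0 mul0r chi0.
Qed.

Lemma size_zres_star q : q != 0 -> (size (zres_star q) < nrm q)%N.
Proof.
move=> q0; apply: leq_trans (size_zres q0).
rewrite size_filter -(count_predC (fun b => b != 0)) -addn1 leq_add2l.
by rewrite -has_count; apply/hasP; exists 0; rewrite ?zres0 //= eqxx.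
Qed.

Lemma sqn_sum_le (I : Type) (s : seq I) (F : I -> C) :
  sqn (\sum_(i <- s) F i) <= (size s)%:R * \sum_(i <- s) sqn (F i).
Proof.
rewrite sqn_sum Re_sum.
apply: le_trans (_ : \sum_(i <- s) \sum_(j <- s) 2^-1 * (sqn (F i) + sqn (F j)) <= _).
  apply: ler_sum => i _; rewrite Re_sum; apply: ler_sum => j _.
  by have := Re_mul_le (F i) (conjc (F j)); rewrite sqn_conj; lra.
have cst (r : R) : \sum_(i <- s) r = (size s)%:R * r.
  by rewrite big_const_seq count_predT iter_addr_0 mulr_natl.
under eq_bigr => i _ do rewrite -mulr_sumr big_split /= cst.
rewrite -mulr_sumr big_split /= cst -mulr_sumr.
by move: (_%:R * \sum_(i <- s) sqn (F i)) => X; lra.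
Qed.

(** As n - nu is never divisible by [q], the nonzero residues b give characters at n - nu with sum
    -1. The plain sum is therefore minus a twisted sum over b, and Cauchy-Schwarz over at most
    [nrm q] - 1 residues concludes. *)
Lemma prime_sieve_ineq q (supp : seq zi) (c : zi -> C) (nu : zi) : zprime q ->
  (forall n, n \in supp -> ~~ zdvd q (n - nu)) ->
  phi_weight R q * sqn (\sum_(n <- supp) c n) <=
  \sum_(b <- zres_star q) sqn (\sum_(n <- supp) c n * chi (cfrac b q) n).
Proof.
move=> pq h; have q0 := zprime_neq0 pq; have q1 := nR_gt1 R pq.
rewrite /phi_weight mulrC ler_pdivrMr ?subr_gt0 //.
pose F b := (\sum_(n <- supp) c n * chi (cfrac b q) n) * conjc (chi (cfrac b q) nu).
have -> : sqn (\sum_(n <- supp) c n) = sqn (\sum_(b <- zres_star q) F b).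
  rewrite -sqnN; congr sqn; rewrite /F.
  under [RHS]eq_bigr => b _ do rewrite mulr_suml.
  rewrite exchange_big /= -sumrN big_seq [RHS]big_seq; apply: eq_bigr => n /h qn.
  transitivity (c n * \sum_(b <- zres_star q) chi (cfrac b q) (n - nu)).
    by rewrite sum_zres_star_chi // mulrN1.
  by rewrite mulr_sumr; apply: eq_bigr => b _; rewrite chi_sub mulrA.
apply: le_trans (sqn_sum_le _ _) _; rewrite mulrC.
under eq_bigr => b _ do rewrite sqnM sqn_conj sqn_chi mulr1.
rewrite ler_wpM2l ?sumr_ge0 // => [b _|]; first exact: sqn_ge0.
by rewrite lerBrDr natr1 ler_nat size_zres_star.
Qed.

(* A pair [(d, a)] stands for the fraction [a / d]. *)
Fixpoint sieve_points (P : seq zi) (D : nat) : seq (zi * zi) :=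
  if P is q :: P' then
    sieve_points P' D ++
    [seq (f.1 * q, f.2 * q + b * f.1) | f <- sieve_points P' (D %/ nrm q), b <- zres_star q]
  else if (0 < D)%N then [:: (1, 0)] else [::].

Lemma sieve_points_nrm P D f : f \in sieve_points P D -> (nrm f.1 <= D)%N.
Proof.
elim: P D f => [|q P IH] D f /=; first by case: ifP => // D0; rewrite inE => /eqP ->.
rewrite mem_cat => /orP[/IH //|/allpairsP[[f' b] /= [h _ ->]]] /=.
rewrite nrmM; apply: leq_trans (leq_trunc_div D (nrm q)).
by rewrite leq_mul2r IH ?orbT.
Qed.

Lemma sieve_points_ndvd P D f q : zprime q -> (forall p, p \in P -> ~~ zdvd q p) ->
  f \in sieve_points P D -> ~~ zdvd q f.1.
Proof.
move=> pq; elim: P D f => [|p P IH] D f h /=.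
  by case: ifP => // _; rewrite inE => /eqP -> /=; rewrite zdvd1 gtn_eqF ?zprime_nrm.
have h' r : r \in P -> ~~ zdvd q r by move=> rP; rewrite h // inE rP orbT.
rewrite mem_cat => /orP[/(IH _ _ h') //|/allpairsP[[f' b] /= [hy _ ->]]] /=.
by rewrite (zprimeM _ _ pq) negb_or (IH _ _ h' hy) h ?mem_head.
Qed.

Lemma sieve_points_neq0 P D f : {in P, forall p, zprime p} -> f \in sieve_points P D -> f.1 != 0.
Proof.
elim: P D f => [|p P IH] D f h /=; first by case: ifP => // _; rewrite inE => /eqP ->.
have h' r : r \in P -> zprime r by move=> rP; rewrite h // inE rP orbT.
rewrite mem_cat => /orP[/(IH _ _ h') //|/allpairsP[[f' b] /= [hy _ ->]]] /=.
by rewrite zi_mulf_eq0 negb_or (IH _ _ h' hy) zprime_neq0 ?h ?mem_head.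
Qed.

Lemma zres_star_ndvd q b : q != 0 -> b \in zres_star q -> ~~ zdvd q b.
Proof.
move=> q0; rewrite mem_filter => /andP[b0 bq]; apply: contraNN b0 => qb.
by apply/eqP/(zres_inj q0) => //; rewrite ?zres0 ?subr0.
Qed.

(** Fractions that differ by a Gaussian integer coincide. Reduction modulo the head prime q decides
    whether q occurs in the denominators and then determines the residue b; after that q cancels and
    induction applies. *)
Lemma sieve_points_sep P D D' f f' : nonassoc_primes P ->
  f \in sieve_points P D -> f' \in sieve_points P D' ->
  zdvd (f.1 * f'.1) (f.2 * f'.1 - f'.2 * f.1) -> f = f'.
Proof.
elim: P D D' f f' => [|q P IH] D D' f f' pP /=.
  by do 2 case: ifP => // _; rewrite !inE => /eqP -> /eqP ->.
have [pq pP' qP] := nonassoc_cons pP; have q0 := zprime_neq0 pq.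
have prP : {in P, forall p, zprime p} by case/nonassoc_primesP: pP'.
have nd D0 g : g \in sieve_points P D0 -> ~~ zdvd q g.1.
  by apply: sieve_points_ndvd => // p /qP[].
have mixed D0 D1 g g' b : g \in sieve_points P D0 -> g' \in sieve_points P D1 ->
    b \in zres_star q -> ~~ zdvd q (g.2 * (g'.1 * q) - (g'.2 * q + b * g'.1) * g.1).
  move=> hz hz' hb; apply/negP => h.
  have : zdvd q (b * g'.1 * g.1).
    have -> : b * g'.1 * g.1 = q * (g.2 * g'.1 - g'.2 * g.1)
      - (g.2 * (g'.1 * q) - (g'.2 * q + b * g'.1) * g.1) by ring.
    by rewrite zdvdB // zdvd_mulr ?zdvd_refl.
  rewrite !(zprimeM _ _ pq) (negPf (nd _ _ hz)) (negPf (nd _ _ hz')).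
  by rewrite (negPf (zres_star_ndvd q0 hb)).
rewrite !mem_cat => /orP[hy|/allpairsP[[g b] /= [hz hb ->]]];
  move=> /orP[hy'|/allpairsP[[g' b'] /= [hz' hb' ->]]] /=.
- exact: IH pP' hy hy'.
- move=> h; case/negP: (mixed _ _ _ _ _ hy hz' hb'); apply: zdvd_trans h.
  by rewrite zdvd_mull ?zdvd_mull ?zdvd_refl.
- move=> h; case/negP: (mixed _ _ _ _ _ hy' hz hb); rewrite -zdvdN opprB; apply: zdvd_trans h.
  by rewrite -mulrA zdvd_mull ?zdvd_mulr ?zdvd_refl.
have -> : g.1 * q * (g'.1 * q) = q * (q * (g.1 * g'.1)) by ring.
have -> : (g.2 * q + b * g.1) * (g'.1 * q) - (g'.2 * q + b' * g'.1) * (g.1 * q) =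
  q * (q * (g.2 * g'.1 - g'.2 * g.1) + (b - b') * (g.1 * g'.1)) by ring.
rewrite zdvd_pmul2l // => h.
have ebb : b = b'.
  have : zdvd q ((b - b') * (g.1 * g'.1)).
    have -> : (b - b') * (g.1 * g'.1) = (q * (g.2 * g'.1 - g'.2 * g.1) +
       (b - b') * (g.1 * g'.1)) - q * (g.2 * g'.1 - g'.2 * g.1) by ring.
    rewrite zdvdB ?zdvd_mulr ?zdvd_refl //; apply: zdvd_trans h.
    by rewrite zdvd_mulr ?zdvd_refl.
  rewrite !(zprimeM _ _ pq) (negPf (nd _ _ hz)) (negPf (nd _ _ hz')) !orbF.
  by apply: zres_inj => //; [move: hb|move: hb']; rewrite mem_filter => /andP[].
move: h; rewrite -ebb subrr mul0r addr0 zdvd_pmul2l // => h.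
by rewrite (IH _ _ _ _ pP' hz hz' h).
Qed.

Lemma uniq_sieve_points P D : nonassoc_primes P -> uniq (sieve_points P D).
Proof.
elim: P D => [|q P IH] D pP /=; first by case: ifP.
have [pq pP' qP] := nonassoc_cons pP; have q0 := zprime_neq0 pq.
rewrite cat_uniq IH //=; apply/andP; split.
  apply/hasPn => _ /allpairsP[[g b] /= [hz hb ->]]; apply/negP => /(sieve_points_ndvd pq).
  case/(_ (fun p pP => (qP p pP).1))/negP => /=.
  by rewrite zdvd_mull ?zdvd_refl.
apply: allpairs_uniq; [exact: IH | exact/filter_uniq/uniq_zres |].
move=> [g b] [g' b'] /allpairsP[[u v] /= [hz hb [-> ->]]].
move=> /allpairsP[[u' v'] /= [hz' hb' [-> ->]]] E.
have e1 : u.1 * q = u'.1 * q := congr1 fst E.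
have e2 : u.2 * q + v * u.1 = u'.2 * q + v' * u'.1 := congr1 snd E.
have euu : u.1 = u'.1 by apply: (zi_mulfI q0); rewrite mulrC e1 mulrC.
have u0 : u.1 != 0 by apply: sieve_points_neq0 hz; case/nonassoc_primesP: pP'.
have nd : ~~ zdvd q u.1 by apply: sieve_points_ndvd hz => // p /qP[].
have evv : v = v'.
  have : zdvd q ((v - v') * u.1).
    have -> : (v - v') * u.1 = q * (u'.2 - u.2).
      by apply/eqP; rewrite -subr_eq0; apply/eqP;
        transitivity ((u.2 * q + v * u.1) - (u'.2 * q + v' * u.1)); [ring|rewrite e2 euu; ring].
    by rewrite zdvd_mulr ?zdvd_refl.
  rewrite (zprimeM _ _ pq) (negPf nd) orbF.
  by apply: zres_inj => //; [move: hb|move: hb']; rewrite mem_filter => /andP[].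
rewrite evv; congr (_, _); rewrite [u]surjective_pairing [u']surjective_pairing euu.
congr (_, _); apply: (zi_mulfI q0); apply: (addIr (v' * u'.1)).
by rewrite mulrC [in RHS]mulrC -e2 evv euu.
Qed.

(** Montgomery's inequality is multiplicative: after the step at the prime q, the induction
    hypothesis is applied to the coefficients twisted by the character of b / q, and the two
    fractions add up to a sieve point. *)
Lemma sieve_points_ineq P D (supp : seq zi) (c : zi -> C) : nonassoc_primes P ->
  (forall q, q \in P -> exists nu, forall n, n \in supp -> ~~ zdvd q (n - nu)) ->
  subset_sum (phi_weight R) P D * sqn (\sum_(n <- supp) c n) <=
  \sum_(f <- sieve_points P D) sqn (\sum_(n <- supp) c n * chi (cfrac f.2 f.1) n).
Proof.
move=> pP h; elim: P D c pP h => [|q P IH] D c pP h /=.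
  case: ifP => D0; last by rewrite big_nil mul0r.
  rewrite big_seq1 mul1r le_eqVlt; apply/orP; left; apply/eqP; congr sqn.
  by apply: eq_bigr => n _; rewrite /cfrac toC0 mul0r chi0 mulr1.
have [pq pP' qP] := nonassoc_cons pP; have q0 := zprime_neq0 pq.
have h' r : r \in P -> exists nu, forall n, n \in supp -> ~~ zdvd r (n - nu).
  by move=> rP; apply: h; rewrite inE rP orbT.
have prP : {in P, forall p, zprime p} by case/nonassoc_primesP: pP'.
rewrite big_cat mulrDl; apply: lerD; first exact: IH.
rewrite big_allpairs_dep exchange_big /=.
have [nu hnu] := h q (mem_head _ _).
apply: le_trans (_ : subset_sum (phi_weight R) P (D %/ nrm q) *
   \sum_(b <- zres_star q) sqn (\sum_(n <- supp) c n * chi (cfrac b q) n) <= _).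
  rewrite [leLHS]mulrAC mulrC ler_wpM2l ?subset_sum_ge0 //; last exact: prime_sieve_ineq hnu.
  by move=> r /prP/phi_weight_ge0.
rewrite mulr_sumr; apply: ler_sum => b _.
apply: le_trans (IH _ _ pP' h') _; rewrite big_seq [leRHS]big_seq; apply: ler_sum => f hy.
rewrite le_eqVlt; apply/orP; left; apply/eqP; congr sqn; apply: eq_bigr => n _.
rewrite -mulrA -chi_addl; congr (_ * chi _ _).
have y0 : toC f.1 != 0 by rewrite toC_eq0; exact: sieve_points_neq0 hy.
have q0' : toC q != 0 by rewrite toC_eq0.
by rewrite /cfrac toCD !toCM; field; rewrite q0' y0.
Qed.

End Sieve.

(** * Primes in a residue class and a box: a Brun-Titchmarsh bound *)

Section PrimesInProgressions.
Variable R : realType.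
Implicit Types x y d n m p q u v : zi.
Local Notation C := R[i].
Local Notation nR q := ((nrm q)%:R : R).
Local Notation toC := (@GI_gtoC R).
Implicit Types (z w : C) (t : R).

Lemma in_bin_diff (L : nat) w z z' : (0 < L)%N -> in_bin L w z -> in_bin L w z' ->
  exists k : zi, sqn (z - z' - toC k) < 2 / L%:R ^+ 2.
Proof.
move=> L0 /andP[a1 a2] /andP[b1 b2]; have L0' : (0 : R) < L%:R by rewrite ltr0n.
have key (s t : R) : frac_part s < L%:R^-1 -> frac_part t < L%:R^-1 ->
    (s - t - (Num.floor s - Num.floor t)%:~R) ^+ 2 < (L%:R ^+ 2)^-1.
  have /andP[s0 _] := frac_itv s; have /andP[t0 _] := frac_itv t.
  rewrite rmorphB /= => s1 t1.
  have -> : s - t - ((Num.floor s)%:~R - (Num.floor t)%:~R) = frac_part s - frac_part t.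
    by rewrite /frac_part; ring.
  rewrite -exprVn -subr_gt0 subr_sqr; set i := L%:R^-1 in s1 t1 *.
  by rewrite mulr_gt0 //; lra.
exists (Num.floor (complex.Re (z - w)) - Num.floor (complex.Re (z' - w)),
        Num.floor (complex.Im (z - w)) - Num.floor (complex.Im (z' - w))).
have h1 := key _ _ a1 b1; have h2 := key _ _ a2 b2.
rewrite /sqn; set i := (L%:R ^+ 2)^-1 in h1 h2 *.
have -> : 2 * i = i + i by ring.
apply: ltrD; [apply: le_lt_trans h1|apply: le_lt_trans h2];
  rewrite le_eqVlt; apply/orP; left; apply/eqP; congr (_ ^+ 2);
  by case: (z) (z') (w) => [? ?] [? ?] [? ?] /=; ring.
Qed.

(** Multiplied by both denominators, the difference of two such fractions modulo Z[i] is a Gaussian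
    integer of norm below M^2 times 2 / (2 M)^2 = 1/2, hence 0. This fixes the level of the sieve at
    norm [M] for a box of side [M]. *)
Lemma sieve_points_count P (M : nat) w : (0 < M)%N -> nonassoc_primes P ->
  (count (fun f : zi * zi => in_bin (2 * M) w (cfrac R f.2 f.1)) (sieve_points P M) <= 1)%N.
Proof.
move=> M0 pP; rewrite -size_filter.
set s := [seq f <- _ | _]; have us : uniq s by exact/filter_uniq/uniq_sieve_points.
have prP : {in P, forall p, zprime p} by case/nonassoc_primesP: pP.
have all_eq : {in s &, forall f g, f = g}.
  move=> f g; rewrite !mem_filter => /andP[bf fs] /andP[bg gs].
  apply: (sieve_points_sep pP fs gs).
  have [|k hk] := in_bin_diff _ bf bg; first by rewrite muln_gt0.
  have f0 := sieve_points_neq0 prP fs; have g0 := sieve_points_neq0 prP gs.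
  have f0' : toC f.1 != 0 by rewrite toC_eq0.
  have g0' : toC g.1 != 0 by rewrite toC_eq0.
  set m := f.2 * g.1 - g.2 * f.1 - f.1 * g.1 * k.
  have em : toC m = (cfrac R f.2 f.1 - cfrac R g.2 g.1 - toC k) * (toC f.1 * toC g.1).
    by rewrite /m !toCB !toCM /cfrac; field; rewrite g0'.
  suff m0 : m = 0.
    apply/zdvdP; exists k; apply/eqP; rewrite -subr_eq0; exact/eqP.
  apply/eqP; rewrite -nrm_eq0 -leqn0 -ltnS -(ltr_nat R) -sqn_toC em !sqnM !sqn_toC.
  have M0' : (0 : R) < M%:R by rewrite ltr0n.
  apply: le_lt_trans (_ : sqn (cfrac R f.2 f.1 - cfrac R g.2 g.1 - toC k) * (M%:R * M%:R) < _).
    by rewrite ler_wpM2l ?sqn_ge0 // ler_pM // ler_nat ?(sieve_points_nrm fs) ?(sieve_points_nrm gs).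
  apply: lt_trans (_ : 2 / (2 * M)%:R ^+ 2 * (M%:R * M%:R) < _).
    by rewrite ltr_pM2r ?mulr_gt0.
  have -> : 2 / (2 * M)%:R ^+ 2 * (M%:R * M%:R) = 1 / 2 :> R.
    by rewrite natrM; field; rewrite lt0r_neq0.
  by lra.
case: (s) us all_eq => [//|f [//|g s']] /= /andP[/negP fg _] h; case: fg.
by rewrite (h f g) ?mem_head // inE mem_head orbT.
Qed.

(** With all coefficients 1, Montgomery's inequality and the large sieve at K = 1 enclose the same
    sum; one factor [size supp] cancels. *)
Lemma sieve_size_le P (M : nat) (n0 : zi) (supp : seq zi) : (0 < M)%N ->
  nonassoc_primes P -> uniq supp ->
  (forall n, n \in supp -> exists k l : nat, [/\ (k < M)%N, (l < M)%N & n = n0 + (k%:Z, l%:Z)]) ->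
  (forall q, q \in P -> exists nu, forall n, n \in supp -> ~~ zdvd q (n - nu)) ->
  (size supp)%:R * subset_sum (phi_weight R) P M <= 192 ^+ 2 * M%:R ^+ 2.
Proof.
move=> M0 pP us hs hP; have [s0|s0] := posnP (size supp).
  by rewrite s0 mul0r mulr_ge0 ?sqr_ge0.
have s0' : (0 : R) < (size supp)%:R by rewrite ltr0n.
have := @large_sieve R _ (sieve_points P M) (fun f => cfrac R f.2 f.1) M 1 n0 supp
  (fun _ => 1) M0 isT us hs (fun w => sieve_points_count w M0 pP).
have := @sieve_points_ineq R P M supp (fun _ => 1) pP hP.
have -> : \sum_(n <- supp) (1 : C) = ((size supp)%:R%:C)%C.
  by rewrite big_const_seq count_predT iter_addr_0 rmorph_nat.
have -> : \sum_(n <- supp) sqn (1 : C) = (size supp)%:R.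
  by rewrite big_const_seq count_predT iter_addr_0; congr (_ *+ _); rewrite /sqn /=; ring.
have -> : sqn (((size supp)%:R%:C)%C : C) = (size supp)%:R ^+ 2 by rewrite /sqn /=; ring.
move=> h1 h2; have := le_trans h1 h2.
by rewrite expr2 mulrA ler_pM2r // mulr1 mulrC.
Qed.

(** The first summand multiplies the losses of [subset_sum_phi_ge], the large sieve and
    [prod_phi_weight_le]. The 18 pays for primes of norm at most M: 9 M times M, with ln ln Q >=
    1/2. *)
Definition sieve_const : R := 32 * 192 ^+ 2 * (expR 32 * 200 ^+ 2) + 18.

Lemma sieve_const_gt0 : 0 < sieve_const.
Proof. by rewrite ltr_wpDl // !mulr_ge0 ?expR_ge0 ?exprn_ge0. Qed.

(** Primes of norm at most [M] may be associates of sieving primes and are counted trivially. A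
    larger prime c + r n is divisible by no q in [primes_upto M], so for q not dividing r the index
    n avoids the class of -c / r modulo q. Leaving out the q that divide r costs the factor ln ln
    Q. *)
Theorem brun_titchmarsh (Q M : nat) (c r n0 : zi) (ps : seq zi) :
  (16 <= Q)%N -> r != 0 -> (nrm r <= Q ^ 2)%N -> (0 < M)%N -> uniq ps ->
  (forall p, p \in ps -> zprime p /\
     exists k l : nat, [/\ (k < M)%N, (l < M)%N & p = c + r * (n0 + (k%:Z, l%:Z))]) ->
  (size ps)%:R * (1 + ln M%:R) <= sieve_const * M%:R ^+ 2 * ln (ln (Q%:R : R)).
Proof.
move=> Q16 r0 rQ M0 ups hps; have [L2 LL] := @lnln_ge R Q Q16.
have M1 : (1 : R) <= M%:R by rewrite ler1n.
have lM : 0 <= ln (M%:R : R) by rewrite ln_ge0.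
have lM1 : 1 + ln (M%:R : R) <= M%:R.
  by have := @ln_le_sub1 R M%:R; rewrite ltr0n => /(_ M0); lra.
set ell := ln (ln _) in LL *.
pose small := [seq p <- ps | (nrm p <= M)%N].
pose large := [seq p <- ps | ~~ (nrm p <= M)%N].
have -> : size ps = (size small + size large)%N by rewrite !size_filter count_predC.
rewrite natrD mulrDl.
have hsmall : (size small)%:R * (1 + ln M%:R) <= 18 * M%:R ^+ 2 * ell.
  have h : (size small <= 9 * M)%N.
    apply: leq_trans (size_zball M); apply: uniq_leq_size; first exact: filter_uniq.
    move=> p; rewrite mem_filter mem_zball => /andP[-> /hps[/zprime_neq0]].
    by rewrite nrm_gt0 => ->.
  apply: le_trans (_ : 9 * M%:R * M%:R <= _).
    by rewrite ler_pM ?addr_ge0 // -natrM ler_nat.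
  have := sqr_ge0 (M%:R : R); rewrite expr2; set m := M%:R * M%:R => m0.
  by rewrite -mulrA -/m; nra.
have hlarge : (size large)%:R * (1 + ln M%:R) <=
    32 * 192 ^+ 2 * (expR 32 * 200 ^+ 2) * M%:R ^+ 2 * ell.
  pose box : seq zi := [seq n0 + (k%:Z, l%:Z) | k <- iota 0 M, l <- iota 0 M].
  have ubox : uniq box.
    apply: allpairs_uniq; rewrite ?iota_uniq // => -[k l] [k' l'] _ _ /addrI.
    by move=> /= [-> ->].
  pose supp := [seq n <- box | c + r * n \in large].
  have usupp : uniq supp by exact: filter_uniq.
  have hsupp n : n \in supp ->
      exists k l : nat, [/\ (k < M)%N, (l < M)%N & n = n0 + (k%:Z, l%:Z)].
    rewrite mem_filter => /andP[_ /allpairsP[[k l] /= []]]; rewrite !mem_iota.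
    by move=> /andP[_ kM] /andP[_ lM' ->]; exists k, l.
  have size_le : (size large <= size supp)%N.
    rewrite -(size_map (fun n => c + r * n) supp).
    apply: uniq_leq_size => [|p pl]; first exact: filter_uniq.
    have [_ [k [l [kM lM' e]]]] : zprime p /\ exists k l : nat,
        [/\ (k < M)%N, (l < M)%N & p = c + r * (n0 + (k%:Z, l%:Z))].
      by apply: hps; move: pl; rewrite mem_filter => /andP[].
    apply/mapP; exists (n0 + (k%:Z, l%:Z)); rewrite // mem_filter -e pl /=.
    by apply/allpairsP; exists (k, l); rewrite !mem_iota.
  pose P := primes_upto M; have pP := primes_uptoP M.
  pose P1 := [seq q <- P | ~~ zdvd q r]; have pP1 : nonassoc_primes P1 by exact: nonassoc_filter.
  have prP : {in P, forall q, zprime q} by case/nonassoc_primesP: pP.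
  have avoid q : q \in P1 -> exists nu, forall n, n \in supp -> ~~ zdvd q (n - nu).
    rewrite mem_filter => /andP[qr qP]; have pq := prP _ qP.
    have [t qt] := zprime_coprime_inv pq qr; exists (- (t * c)) => n.
    rewrite !mem_filter -andbA => /andP[big /andP[/hps[pp _] _]]; apply: contra big => h.
    have : zdvd q (c + r * n).
      have -> : c + r * n = c * (1 - t * r) + r * (n - - (t * c)) by ring.
      by rewrite zdvdD // zdvd_mull.
    by move=> /(zprime_dvd_nrm pq pp) <-; exact: primes_upto_nrm.
  have h1 := sieve_size_le M0 pP1 usupp hsupp avoid.
  have h2 := @subset_sum_filter R (phi_weight R) P M (fun q => ~~ zdvd q r)
    (fun q qP => phi_weight_ge0 R (prP q qP)).
  have h3 := @subset_sum_phi_ge R M M0.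
  have h4 : \prod_(q <- P | ~~ ~~ zdvd q r) (1 + phi_weight R q) <= expR 32 * 200 ^+ 2 * ell.
    rewrite -big_filter; apply: (@prod_phi_weight_le R Q _ r) => //.
      exact: nonassoc_filter.
    by move=> q; rewrite mem_filter negbK => /andP[].
  move: h1 h2 h3 h4; rewrite -/P -/P1.
  set G1 := subset_sum _ P1 M; set G := subset_sum _ P M; set F := \prod_(_ <- _ | _) _.
  set K := expR 32 * 200 ^+ 2 => h1 h2 h3 h4.
  have G10 : 0 <= G1.
    apply: subset_sum_ge0 => q; rewrite mem_filter => /andP[_ qP].
    exact/phi_weight_ge0/prP.
  have sl : (size large)%:R <= (size supp)%:R :> R by rewrite ler_nat.
  have K0 : 0 <= K * ell by rewrite !mulr_ge0 ?expR_ge0 ?sqr_ge0 //; lra.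
  have step : (1 + ln M%:R) <= 32 * (G1 * (K * ell)).
    have := le_trans h2 (ler_wpM2l G10 h4); lra.
  apply: le_trans (_ : (size supp)%:R * (32 * (G1 * (K * ell))) <= _).
    by rewrite ler_pM ?addr_ge0.
  have := ler_wpM2r K0 h1; lra.
by rewrite /sieve_const; lra.
Qed.

End PrimesInProgressions.

(** * Fractions near a point *)

Section CountingFractions.
Variable R : realType.
Implicit Types x y d n m p q u v : zi.
Local Notation C := R[i].
Local Notation nR q := ((nrm q)%:R : R).
Local Notation toC := (@GI_gtoC R).
Implicit Types (z w : C) (t : R).

Lemma in_bin_corner (L : nat) z : (0 < L)%N ->
  in_bin L (Complex ((bin L (complex.Re z))%:R / L%:R) ((bin L (complex.Im z))%:R / L%:R)) z.
Proof.
move=> L0; apply/andP; split.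
  have -> (u v : R) : complex.Re (z - Complex u v) = complex.Re z - u by case: z.
  exact: frac_bin.
have -> (u v : R) : complex.Im (z - Complex u v) = complex.Im z - v by case: z.
exact: frac_bin.
Qed.

Lemma odd_sq_le (h : nat) : ((2 * h).+1 ^ 2 <= 8 * h ^ 2 + 2)%N.
Proof. by case: h => [//|h]; rewrite -!mulnn; nia. Qed.

Lemma nrm_lt_coord n (h : nat) : (nrm n < h.+1 ^ 2)%N -> (`|n.1| <= h)%N /\ (`|n.2| <= h)%N.
Proof. by rewrite /nrm; nia. Qed.

Lemma shift_index (a : int) (h : nat) : (`|a| <= h)%N ->
  exists k : nat, (k < (2 * h).+1)%N /\ a = - h%:Z + k%:Z.
Proof. by move=> ah; exists (absz (a + h%:Z)); split; lia. Qed.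

(** Pigeonhole: (T + 1)^2 multipliers against T^2 cells of side 1 / T. *)
Lemma dirichlet_gauss z (T : nat) : (0 < T)%N ->
  exists r b : zi, [/\ r != 0, (nrm r <= 2 * T ^ 2)%N & sqn (toC r * z - toC b) <= 2 / T%:R ^+ 2].
Proof.
move=> T0; pose box : seq zi := [seq (k%:Z, l%:Z) | k <- iota 0 T.+1, l <- iota 0 T.+1].
have ubox : uniq box.
  by apply: allpairs_uniq; rewrite ?iota_uniq // => -[k l] [k' l'] _ _ /= [-> ->].
pose f (r : zi) := (bin T (complex.Re (toC r * z)), bin T (complex.Im (toC r * z))).
have [[r [r' [rb rb' rr ff]]]|inj] :=
    pselect (exists r r' : zi, [/\ r \in box, r' \in box, r != r' & f r = f r']).
  have hb := in_bin_corner (toC r * z) T0; have hb' := in_bin_corner (toC r' * z) T0.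
  move: ff hb hb'; rewrite /f => -[-> ->] hb hb'.
  have [k hk] := in_bin_diff T0 hb hb'; exists (r - r'), k; split.
  - by rewrite subr_eq0.
  - move: rb rb' => /allpairsP[[i j] [+ + ->]] /allpairsP[[i' j'] [+ + ->]].
    rewrite !mem_iota !add0n /nrm /= => h1 h2 h3 h4.
    have -> : (2 * T ^ 2 = T ^ 2 + T ^ 2)%N by lia.
    by apply: leq_add; rewrite leq_exp2r //; lia.
  - by rewrite toCB mulrBl ltW.
have : (size [seq f r | r <- box] <= size [seq (k, l) | k <- iota 0 T, l <- iota 0 T])%N.
  apply: uniq_leq_size.
    rewrite map_inj_in_uniq // => r r' rb rb' ff; apply/eqP/negPn/negP => rr.
    by apply: inj; exists r, r'.
  move=> _ /mapP[r _ ->]; apply/allpairsP; exists (f r).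
  by rewrite !mem_iota !add0n /f /= !bin_lt.
by rewrite size_map !size_allpairs !size_iota; nia.
Qed.

(** Cancelling the gcd only decreases [nrm r], so both bounds persist. The Bezout relation is kept
    because [b] has to be cancelled modulo [r]. *)
Lemma dirichlet_coprime z (T : nat) : (0 < T)%N ->
  exists r b s t : zi, [/\ r != 0, (nrm r <= 2 * T ^ 2)%N, s * r + t * b = 1 &
    sqn (z - cfrac R b r) * (T%:R ^+ 2 * nR r) <= 2].
Proof.
move=> T0; have [r [b [r0 rT h]]] := dirichlet_gauss z T0.
have [g [s [t [e gr gb]]]] := zbezout r b.
case/zdvdP: gr => r' er; case/zdvdP: gb => b' eb.
have g0 : g != 0 by apply: contraNneq r0 => g0; rewrite er g0 mul0r.
have r'0 : r' != 0 by apply: contraNneq r0 => r0; rewrite er r0 mulr0.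
have nrr : (nrm r' <= nrm r)%N by rewrite er nrmM leq_pmull ?nrm_gt0.
exists r', b', s, t; split => //; first exact: leq_trans rT.
  by apply: (zi_mulfI g0); rewrite mulr1 [RHS]e er eb; ring.
have T0' : (0 : R) < T%:R ^+ 2 by rewrite exprn_gt0 ?ltr0n.
have r0' : toC r != 0 by rewrite toC_eq0.
have eC : cfrac R b' r' = cfrac R b r.
  have g0' : toC g != 0 by rewrite toC_eq0.
  have r'0' : toC r' != 0 by rewrite toC_eq0.
  by rewrite /cfrac er eb !toCM; field; rewrite g0' r'0'.
rewrite eC; move: h; rewrite ler_pdivlMr //; apply: le_trans.
have -> : toC r * z - toC b = toC r * (z - cfrac R b r) by rewrite /cfrac; field.
rewrite sqnM sqn_toC; have -> (A B : R) : nR r * A * B = A * (B * nR r) by ring.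
by rewrite ler_wpM2l ?sqn_ge0 // ler_wpM2l ?(ltW T0') // ler_nat.
Qed.

(** 1872 is 9 times 4, from the number of values m, times 13 times 4, from the area of the box of
    each m. *)
Definition fraction_const : R := 1872 * sieve_const R.

Lemma fraction_const_gt0 : 0 < fraction_const.
Proof. by apply: mulr_gt0 (sieve_const_gt0 R); rewrite ltr0n. Qed.

Section Fractions.
(** [D] is a squared radius around [z], and [kap] a lower bound, uniform in r, for the squared
    radius [YY] of the discs. Of its two upper bounds, [kap1] serves the case where the
    approximation error dominates and [kap2] the case where [D] does. The bound 4/9 keeps 1 + ln kap
    / 2 positive. *)
Variables (Q T : nat) (D kap : R) (z : C) (s : seq (zi * zi)).
Hypotheses (Q16 : (16 <= Q)%N) (T0 : (0 < T)%N) (TQ : (2 * T ^ 2 <= Q ^ 2)%N).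
Hypotheses (D0 : 0 < D) (kap0 : 4 / 9 <= kap).
Hypotheses (kap1 : kap <= 2 * Q%:R * D * T%:R ^+ 2) (kap2 : kap * T%:R ^+ 2 <= 2 * Q%:R).
Hypothesis (us : uniq s).
Hypothesis hs : forall f, f \in s ->
  [/\ zprime f.1, (nrm f.1 <= Q)%N, ~~ zdvd f.1 f.2 & sqn (cfrac R f.2 f.1 - z) <= D].

Lemma count_fractions :
  (size s)%:R <= 4 + fraction_const * Q%:R ^+ 2 * D * ln (ln Q%:R) / (1 + ln kap / 2).
Proof.
have [r [b [s0 [t0 [r0 rT bez hz]]]]] := dirichlet_coprime z T0.
have kp : 0 < kap by apply: lt_le_trans kap0; lra.
have k0 := ltW kp.
have cop x : zdvd r (b * x) -> zdvd r x.
  move=> h; have -> : x = r * (s0 * x) + b * x * t0.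
    by rewrite -[LHS]mul1r -bez; ring.
  by apply: zdvdD; [exact: zdvd_mulr (zdvd_refl r) | exact: zdvd_mulr h].
pose zeta := z - cfrac R b r; pose H := Num.max (sqn zeta) D.
have r0' : toC r != 0 by rewrite toC_eq0.
have Qpos : (0 : R) < Q%:R by rewrite ltr0n (leq_trans _ Q16).
have nr0 : 0 < nR r by rewrite ltr0n nrm_gt0.
have H0 : 0 < H by rewrite lt_max D0 orbT.
pose mm (f : zi * zi) := f.2 * r - b * f.1.
have mmE f : f \in s -> toC (mm f) = toC f.1 * toC r * (zeta + (cfrac R f.2 f.1 - z)).
  move=> /hs[/zprime_neq0 + _ _ _]; rewrite -(toC_eq0 R) => p0.
  by rewrite /mm /zeta toCB !toCM /cfrac; field; rewrite ?p0 ?r0'.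
have nrmQ f : f \in s -> nR f.1 <= Q%:R by move=> /hs[_ + _ _]; rewrite ler_nat.
pose B := Num.truncn (4 * Q%:R * nR r * H).
(* By [mmE], m = p r (zeta + error), where both squared moduli in the bracket are at most H; hence 4
   H. *)
have B0 : 0 <= 4 * Q%:R * nR r * H by rewrite !mulr_ge0 // ltW.
have mmB f : f \in s -> (nrm (mm f) <= B)%N.
  move=> fs; rewrite truncn_ge_nat // -(sqn_toC R (mm f)) mmE // !sqnM !sqn_toC.
  have [_ _ _ he] := hs fs.
  have h1 : sqn (zeta + (cfrac R f.2 f.1 - z)) <= 4 * H.
    apply: le_trans (sqnD_le _ _) _.
    have : sqn zeta <= H by rewrite le_max lexx.
    have : D <= H by rewrite le_max lexx orbT.
    by lra.
  apply: le_trans (_ : Q%:R * nR r * (4 * H) <= _); last by lra.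
  by rewrite ler_pM ?mulr_ge0 ?sqn_ge0 // ler_wpM2r // nrmQ.
(* For fixed m the prime determines the numerator, so primes can be counted in place of pairs. *)
have fst_inj m : {in [seq f <- s | mm f == m] &, injective (fun f : zi * zi => f.1)}.
  move=> [p a] [p' a']; rewrite !mem_filter /mm /= => /andP[/eqP em _] /andP[/eqP em' _] epp.
  congr (_, _) => //; apply: (zi_mulfI r0); rewrite ![r * _]mulrC.
  by apply: (addIr (- (b * p))); rewrite em epp em'.
(* Two pairs with m = 0 represent the same fraction: a0 p = a p0. As p0 does not divide a0, p is p0
   times one of the four units. *)
have zero_count : (count (fun f => mm f == 0%R) s <= 4)%N.
  rewrite -size_filter -(size_map (fun f : zi * zi => f.1)).
  case E: [seq f <- s | mm f == 0%R] => [//|[p0 a0] s']; rewrite -E.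
  have : (p0, a0) \in [seq f <- s | mm f == 0%R] by rewrite E mem_head.
  rewrite mem_filter => /andP[/eqP m0 /hs[/= pp0 _ pa0 _]].
  pose us4 : seq zi := [:: p0 * ((1, 0) : zi); p0 * ((-1, 0) : zi); p0 * ((0, 1) : zi); p0 * ((0, -1) : zi)].
  rewrite -[4%N]/(size us4); apply: uniq_leq_size.
    by rewrite map_inj_in_uniq ?filter_uniq //; exact: fst_inj.
  move=> _ /mapP[[p a] + ->] /=; rewrite mem_filter => /andP[/eqP m1 /hs[/= pp _ pa _]].
  have e1 : a0 * p = a * p0.
    apply: (zi_mulfI r0).
    have -> : r * (a0 * p) = mm (p0, a0) * p + b * p0 * p by rewrite /mm /=; ring.
    have -> : r * (a * p0) = mm (p, a) * p0 + b * p * p0 by rewrite /mm /=; ring.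
    by rewrite m0 m1; ring.
  have hd : zdvd p0 p.
    have : zdvd p0 (a0 * p) by rewrite e1; exact: zdvd_mull (zdvd_refl _).
    by rewrite (zprimeM _ _ pp0) (negPf pa0).
  have en := zprime_dvd_nrm pp0 pp hd; case/zdvdP: hd => k ek.
  have k1 : nrm k = 1%N.
    have n0 : (0 < nrm p0)%N by rewrite ltnW ?zprime_nrm.
    by apply/eqP; rewrite -(eqn_pmul2l n0) muln1 -nrmM -ek en.
  by rewrite ek /us4 !inE; case: (unit_cases k1) => ->; rewrite eqxx ?orbT.
(* Bounds the norm of n = (p - p0) / r when both primes share m. Multiplied by the bound behind [B]
   it gives 16 Q^2 D, free of r and H. *)
pose YY := 4 * Q%:R * D / (H * nR r).
have Hr0 : 0 < H * nR r by rewrite mulr_gt0.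
have YYk : kap <= YY.
  rewrite ler_pdivlMr // /H; have [_|_] := leP (sqn zeta) D.
    have : nR r <= 2 * T%:R ^+ 2 by rewrite -natrX -natrM ler_nat.
    move=> h; apply: le_trans (_ : kap * (D * (2 * T%:R ^+ 2)) <= _).
      by rewrite ler_wpM2l ?(ler_wpM2l (ltW D0)).
    have := ler_wpM2l (ltW D0) kap2; lra.
  have hz' : sqn zeta * (T%:R ^+ 2 * nR r) <= 2 by exact: hz.
  apply: le_trans (_ : 2 * Q%:R * D * T%:R ^+ 2 * (sqn zeta * nR r) <= _).
    by rewrite ler_wpM2r // mulr_ge0 ?sqn_ge0.
  have c0 : 0 <= 2 * Q%:R * D by rewrite !mulr_ge0 // ltW.
  have := ler_wpM2l c0 hz'; lra.
have YY0 : 0 <= YY by lra.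
have [h /andP[h1 h2]] := sqrtn_exists (Num.truncn YY).
pose W := (2 * h).+1.
have W0 : (0 < W)%N by [].
(* W^2 <= 8 YY + 2, and 2 <= 5 YY since YY >= 4/9. *)
have W1 : (W%:R : R) ^+ 2 <= 13 * YY.
  have : (h ^ 2)%:R <= YY by apply: le_trans (_ : (Num.truncn YY)%:R <= _); rewrite ?ler_nat ?truncn_le.
  have : (W%:R : R) ^+ 2 <= 8 * (h ^ 2)%:R + 2.
    by rewrite -natrX -natrM -natrD ler_nat odd_sq_le.
  have key (a c y : R) : 4 / 9 <= y -> a <= 8 * c + 2 -> c <= y -> a <= 13 * y by lra.
  exact: key (le_trans kap0 YYk).
have W2 : kap <= (W%:R : R) ^+ 2.
  apply: le_trans YYk _; apply: ltW; apply: lt_le_trans (truncnS_gt YY) _.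
  by rewrite -natrX ler_nat (leq_trans h2) // leq_exp2r // /W ltnS mulSn leq_addr.
have lam : 1 + ln kap / 2 <= 1 + ln (W%:R : R).
  have W0' : (0 : R) < W%:R by rewrite ltr0n.
  have : ln kap <= ln ((W%:R : R) ^+ 2) by rewrite ler_ln ?posrE ?exprn_gt0.
  by rewrite lnXn // mulr2n; lra.
(* ln(9/4) <= 9/4 - 1 gives 1 + ln(4/9) / 2 >= 3/8. *)
have lam0 : 0 < 1 + ln kap / 2.
  have p49 : (0 : R) < 4 / 9 by lra.
  have key (a c : R) : - a <= (4 / 9)^-1 - 1 -> a <= c -> 0 < 1 + c / 2 by lra.
  apply: (key (ln (4 / 9))); last by rewrite ler_ln ?posrE.
  by rewrite -lnV ?posrE //; apply: ln_le_sub1; rewrite invr_gt0.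
set ell := ln (ln _); have [_ LL] := @lnln_ge R Q Q16.
have group m : (count (fun f => mm f == m) s)%:R * (1 + ln W%:R) <= sieve_const R * W%:R ^+ 2 * ell.
  rewrite -size_filter -(size_map (fun f : zi * zi => f.1)).
  set g := [seq f <- s | mm f == m].
  case E: g => [|[p0 a0] g'].
    rewrite mul0r !mulr_ge0 ?sqr_ge0 //; first by rewrite ltW ?sieve_const_gt0.
    by rewrite /ell; lra.
  rewrite -E; have g0 : (p0, a0) \in g by rewrite E mem_head.
  have := g0; rewrite mem_filter => /andP[/eqP m0 f0s].
  apply: (@brun_titchmarsh R Q W p0 r ((- h%:Z, - h%:Z) : zi)) => //.
  - exact: leq_trans TQ.
  - by rewrite map_inj_in_uniq ?filter_uniq //; exact: fst_inj.
  move=> _ /mapP[[p a] + ->] /=; rewrite mem_filter => /andP[/eqP m1 fs].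
  have [pp _ _ he] := hs fs; have [pp0 _ _ he0] := hs f0s; split; first by [].
  (* Equal m makes b (p - p0) divisible by r, and b is invertible modulo r. *)
  have /zdvdP[n en] : zdvd r (p - p0).
    apply: cop; apply/zdvdP; exists (a - a0).
    have -> : b * (p - p0) = r * (a - a0) - (mm (p, a) - mm (p0, a0)) by rewrite /mm /=; ring.
    by rewrite m0 m1 subrr subr0.
  have ep : p = p0 + r * n by rewrite -en; ring.
  have p0Q := nrmQ _ f0s; have pQ := nrmQ _ fs.
  set e1 := cfrac R a p - z in he; set e0 := cfrac R a0 p0 - z in he0.
  rewrite /= -/e1 in he; rewrite /= -/e0 in he0; rewrite /= in p0Q pQ.
  (* If H = D, |p - p0|^2 <= 4 Q suffices. Otherwise equal m gives (p - p0) zeta = p0 e0 - p e1,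
     where both terms on the right have squared modulus at most Q D. *)
  have key : sqn (toC (p - p0)) * H <= 4 * Q%:R * D.
    rewrite /H; have [_|_] := leP (sqn zeta) D.
      rewrite ler_wpM2r ?(ltW D0) // toCB; apply: le_trans (sqnB_le _ _) _.
      by rewrite !sqn_toC; lra.
    rewrite -sqnM.
    have -> : toC (p - p0) * zeta = toC p0 * e0 - toC p * e1.
      have := mmE _ fs; have := mmE _ f0s; rewrite /= -/e1 -/e0 m0 m1 => -> eq.
      have {}eq : toC p0 * (zeta + e0) = toC p * (zeta + e1).
        by apply: (mulfI r0'); rewrite !mulrA ![toC r * _]mulrC.
      rewrite toCB; apply/eqP; rewrite -subr_eq0; apply/eqP.
      by transitivity (toC p * (zeta + e1) - toC p0 * (zeta + e0)); [ring|rewrite eq subrr].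
    apply: le_trans (sqnB_le _ _) _; rewrite !sqnM !sqn_toC.
    have : nR p0 * sqn e0 <= Q%:R * D by rewrite ler_pM ?sqn_ge0.
    have : nR p * sqn e1 <= Q%:R * D by rewrite ler_pM ?sqn_ge0.
    by lra.
  have nY : (nrm n < h.+1 ^ 2)%N.
    apply: leq_ltn_trans h2; rewrite truncn_ge_nat // ler_pdivlMr //.
    by move: key; rewrite en sqn_toC nrmM natrM; lra.
  have [hn1 hn2] := nrm_lt_coord nY.
  have [k [kW ek]] := shift_index hn1; have [l [lW el]] := shift_index hn2.
  exists k, l; split => //; rewrite {1}ep; congr (_ + _ * _).
  by apply: zi_ext; rewrite zi_addE /=.
have total : (size s <= 4 + \sum_(m <- zball B) count (fun f => mm f == m) s)%N.
  rewrite -(count_predC (fun f => mm f == 0%R)); apply: leq_add zero_count _.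
  rewrite -sum1_count.
  have cE m : (count (fun f => mm f == m) s = \sum_(f <- s) (mm f == m))%N.
    by rewrite -sum1_count big_mkcond; apply: eq_bigr => f _; case: (mm f == m).
  under [X in (_ <= X)%N]eq_bigr => m _ do rewrite cE.
  rewrite exchange_big big_mkcond big_seq [X in (_ <= X)%N]big_seq /=.
  apply: leq_sum => f fs; case: ifP => // m0.
  rewrite (big_rem (mm f)) /= ?eqxx // mem_zball nrm_gt0 m0 /=.
  exact: mmB.
apply: le_trans (_ : 4 + \sum_(m <- zball B) (count (fun f => mm f == m) s)%:R <= _).
  by rewrite -natr_sum -natrD ler_nat.
rewrite lerD2l ler_pdivlMr // mulr_suml.
have Cs := sieve_const_gt0 R.
have ell0 : 0 <= ell by rewrite /ell; lra.
apply: le_trans (_ : \sum_(m <- zball B) sieve_const R * (13 * YY) * ell <= _).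
  apply: ler_sum => m _; apply: le_trans (_ : (count (fun f => mm f == m) s)%:R * (1 + ln W%:R) <= _).
    by rewrite ler_wpM2l.
  apply: le_trans (group m) _.
  by rewrite ler_wpM2r // ler_wpM2l // ltW.
rewrite big_const_seq count_predT iter_addr_0 -[leLHS]mulr_natl.
apply: le_trans (_ : 9 * (4 * Q%:R * nR r * H) * (sieve_const R * (13 * YY) * ell) <= _).
  have E0 : 0 <= sieve_const R * (13 * YY) * ell by apply: mulr_ge0 ell0; apply: (mulr_ge0 (ltW Cs)); exact: mulr_ge0.
  rewrite ler_wpM2r //.
  apply: le_trans (_ : (9 * B)%:R <= _); first by rewrite ler_nat size_zball.
  by rewrite natrM ler_wpM2l // truncn_le.
rewrite le_eqVlt; apply/orP; left; apply/eqP; rewrite /YY /fraction_const.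
by field; rewrite !lt0r_neq0.
Qed.

End Fractions.
End CountingFractions.

(** * From residues modulo p to points of the plane, and the choice of parameters *)

Section Assembly.
Variable R : realType.
Implicit Types x y d n m p q u v : zi.
Local Notation C := R[i].
Local Notation toC := (@GI_gtoC R).
Implicit Types (z w : C) (t : R).

Lemma residue_nth_inj p (s : seq gint) a a' : nonzero_residue_system p s ->
  a \in s -> a' \in s -> zdvd p ((a : zi) - (a' : zi)) -> a = a'.
Proof.
move=> [_ [inj _]] sa sa' /gdvdP h; have e := nth_index GI_gzero sa.
have e' := nth_index GI_gzero sa'; rewrite -e -e'; congr nth.
by apply: inj; rewrite ?index_mem // e e'.
Qed.

Lemma residue_uniq p (s : seq gint) : nonzero_residue_system p s -> uniq s.
Proof.
move=> [_ [inj _]]; apply/(uniqP GI_gzero) => i j si sj e; apply: inj => //.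
by rewrite e; apply/gdvdP; rewrite -zi_subE subrr zdvd0.
Qed.

Lemma residue_ndvd p (s : seq gint) a : nonzero_residue_system p s -> a \in s -> ~~ zdvd p (a : zi).
Proof.
move=> [h _] /h sa; apply/negP => pa; apply: sa; apply/gdvdP.
by rewrite -zi_subE [X in zdvd _ X]subr0.
Qed.

(** [in_bin] speaks of points modulo Z[i]; subtracting a multiple of [p] from the numerator moves
    the fraction itself next to [w] and keeps the residue modulo [p]. *)
Lemma lift_in_bin (L : nat) w (p b : zi) : (0 < L)%N -> p != 0 -> in_bin L w (cfrac R b p) ->
  exists k : zi, sqn (cfrac R (b - p * k) p - w) <= 2 / L%:R ^+ 2.
Proof.
move=> L0 p0 /andP[h1 h2]; have p0' : toC p != 0 by rewrite toC_eq0.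
exists (Num.floor (complex.Re (cfrac R b p - w)), Num.floor (complex.Im (cfrac R b p - w))).
set k : zi := (_, _); have -> : cfrac R (b - p * k) p - w = (cfrac R b p - w) - toC k.
  by rewrite /cfrac toCB toCM; field.
have L0' : (0 : R) < L%:R by rewrite ltr0n.
have sq t : frac_part t < L%:R^-1 -> frac_part t ^+ 2 <= (L%:R ^+ 2)^-1.
  move=> h; have /andP[f0 _] := frac_itv t; rewrite -exprVn lerXn2r ?nnegrE ?invr_ge0 // ltW //.
have -> : 2 / L%:R ^+ 2 = (L%:R ^+ 2)^-1 + (L%:R ^+ 2)^-1 :> R by ring.
move: (sq _ h1) (sq _ h2); rewrite /k /sqn /frac_part.
by case: (cfrac R b p - w) => u v /= k1 k2; exact: lerD.
Qed.

Lemma count_in_bin (Q T L : nat) (kap : R) w (ps : seq zi) (res : zi -> seq zi) :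
  (16 <= Q)%N -> (0 < T)%N -> (2 * T ^ 2 <= Q ^ 2)%N -> (0 < L)%N -> 4 / 9 <= kap ->
  kap <= 2 * Q%:R * (2 / L%:R ^+ 2) * T%:R ^+ 2 -> kap * T%:R ^+ 2 <= 2 * Q%:R ->
  uniq ps -> (forall p, p \in ps -> [/\ zprime p, (nrm p <= Q)%N & nonzero_residue_system p (res p)]) ->
  (count (fun f : zi * zi => in_bin L w (cfrac R f.2 f.1)) [seq (p, b) | p <- ps, b <- res p])%:R
  <= 4 + fraction_const R * Q%:R ^+ 2 * (2 / L%:R ^+ 2) * ln (ln Q%:R) / (1 + ln kap / 2).
Proof.
move=> Q16 T0 TQ L0 kap0 kap1 kap2 ups hps.
set s := [seq (p, b) | p <- ps, b <- res p]; rewrite -size_filter; set s' := [seq f <- s | _].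
have hs f : f \in s -> f.1 \in ps /\ f.2 \in res f.1.
  by move=> /allpairsPdep[p [b [pp bb ->]]].
have us : uniq s.
  apply: allpairs_uniq_dep => [//|p /hps[_ _ /residue_uniq //]|].
  by move=> [p b] [p' b'] _ _ /= [-> ->].
(* A choice of translation for each fraction in the square, with a dummy value elsewhere. Lifted
   pairs stay distinct because the residues of one p are incongruent. *)
pose lift (f : zi * zi) : zi :=
  if pselect (exists k, sqn (cfrac R (f.2 - f.1 * k) f.1 - w) <= 2 / L%:R ^+ 2) is left h
  then projT1 (cid h) else 0.
have liftP f : f \in s' -> sqn (cfrac R (f.2 - f.1 * lift f) f.1 - w) <= 2 / L%:R ^+ 2.
  rewrite mem_filter => /andP[hb /hs[/hps[/zprime_neq0 p0 _ _] _]]; rewrite /lift.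
  case: pselect => [h|h]; first by case: (cid h).
  by case: h; exact: lift_in_bin.
rewrite -(size_map (fun f : zi * zi => (f.1, f.2 - f.1 * lift f)) s').
apply: (@count_fractions R Q T (2 / L%:R ^+ 2) kap w) => //.
- by rewrite divr_gt0 ?exprn_gt0 ?ltr0n.
- rewrite map_inj_in_uniq ?filter_uniq // => -[p b] [p' b'].
  rewrite !mem_filter => /andP[_ /hs /= [pp bb]] /andP[_ /hs /= [_ bb']] E.
  have epp : p = p' := congr1 fst E.
  have e2 : b - p * lift (p, b) = b' - p' * lift (p', b') := congr1 snd E.
  rewrite -epp in bb' e2 *; congr (_, _); have [_ _ hr] := hps _ pp.
  apply: residue_nth_inj hr bb bb' _; apply/zdvdP.
  exists (lift (p, b) - lift (p, b')); apply/eqP; rewrite -subr_eq0; apply/eqP.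
  transitivity ((b - p * lift (p, b)) - (b' - p * lift (p, b'))); first by ring.
  by rewrite e2 subrr.
- move=> _ /mapP[f fs ->] /=; have := liftP _ fs.
  move: fs; rewrite mem_filter => /andP[_ /hs[fp fb]] h; have [pp pQ hr] := hps _ fp.
  split => //; apply: contra (residue_ndvd hr fb) => hd.
  have -> : f.2 = (f.2 - f.1 * lift f) + f.1 * lift f by ring.
  by apply: zdvdD => //; exact: zdvd_mulr (zdvd_refl _).
Qed.

Lemma box_side_bounds (N h : nat) : (0 < N)%N -> (h ^ 2 <= N)%N -> (N < h.+1 ^ 2)%N ->
  (4 * N < (2 * (2 * h).+1) ^ 2 <= 36 * N)%N /\ ((2 * h).+1 ^ 2 <= 9 * N)%N.
Proof.
rewrite -!mulnn => N0 h1 h2; have h0 : (0 < h)%N by case: h h1 h2; lia.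
have h3 : (h <= h * h)%N by rewrite leq_pmulr.
by split; [apply/andP; split|]; lia.
Qed.

End Assembly.

Theorem theorem4 (R : realType) :
  exists c1 : R, 0 < c1 /\
  forall (Q N : nat) (delta : R) (a : gint -> R[i])
         (res : gint -> seq gint),
    (16 <= Q)%N ->
    0 < delta -> delta < 1 ->
    (N%:R : R) = (Q%:R : R) `^ (1 + delta) / 16 ->
    (forall p : gint, GI_gprime p -> GI_gnorm p <= Q%:Z ->
       nonzero_residue_system p (res p)) ->
    \sum_(p <- GI_gbox Q | `[< GI_gprime p >] && (GI_gnorm p <= Q%:Z))
       \sum_(b <- res p)
         GI_cabs (\sum_(n <- GI_gbox N | GI_gnorm n <= N%:Z)
                  a n * GI_e (complex.Re (GI_gtoC R (GI_gmul n b) / GI_gtoC R p))) ^+ 2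
    <= c1 / (1 - delta) * ((Q%:R : R) ^+ 2 * ln (ln (Q%:R : R)) / ln (Q%:R : R))
       * \sum_(n <- GI_gbox N | GI_gnorm n <= N%:Z) GI_cabs (a n) ^+ 2.
Proof.
have := @count_in_bin R; have := fraction_const_gt0 R.
(* 9/16 comes from M^2 <= 9 N = 9/16 v^4. In 8 + 32 F, the 8 absorbs the 4 associates, and 32 = 8
   times 4 combines Q^2 D <= 8 u^4 with lam >= X1 / 4. *)
move: (fraction_const R) => F Cs countF; pose c0 : R := 9 / 16 * (8 + 32 * F).
have c00 : 0 < c0 by rewrite mulr_gt0 //; lra.
exists (192 ^+ 2 * c0); split; first by rewrite mulr_gt0 ?exprn_gt0.
move=> Q N delta a res Q16 d0 d1 eN hres; have [L2 LL] := @lnln_ge R Q Q16.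
have Q0 : (0 : R) < Q%:R by rewrite ltr0n (leq_trans _ Q16).
set Lq := ln (Q%:R : R) in L2 LL *; set ell := ln Lq in LL *.
(* u = Q^((1-delta)/4) and v = Q^((1+delta)/4), so that Q = u^2 v^2 and 16 N = v^4. *)
pose u : R := expR ((1 - delta) * Lq / 4); pose v : R := expR ((1 + delta) * Lq / 4).
have u1 : 1 <= u by rewrite -expR0 ler_expR !mulr_ge0 ?invr_ge0 //; lra.
have v1 : 1 <= v by rewrite -expR0 ler_expR !mulr_ge0 ?invr_ge0 //; lra.
have Quv : Q%:R = u ^+ 2 * v ^+ 2 :> R.
  rewrite -[LHS]lnK ?posrE // -/Lq /u /v -!expRM_natl -expRD; congr expR; by field.
have Nv : N%:R = v ^+ 4 / 16 :> R.
  rewrite eN /powR gt_eqF // -/Lq /v -expRM_natl; congr (expR _ / _); by field.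
have v40 : 1 <= v ^+ 4 by rewrite exprn_ege1.
have vp : 0 < v by lra.
have v0 : 0 < v ^+ 4 by exact: exprn_gt0.
have N0 : (0 < N)%N by rewrite -(ltr_nat R) Nv; lra.
have [M0 /andP[M01 M02]] := sqrtn_exists N.
(* M is the side of a square centred at 0 that contains the support, and L = 2 M the kernel length.
   As L^2 lies between 4 N and 36 N, the squared diagonal D = 2 / L^2 of a cell has order 1 /
   v^4. *)
pose M := (2 * M0).+1; pose L := (2 * M)%N.
have L0 : (0 < L)%N by [].
have [/andP[LN1 LN2] MN] := box_side_bounds N0 M01 M02; rewrite -/M -/L in LN1 LN2 MN.
pose D : R := 2 / L%:R ^+ 2.
have L20 : (0 : R) < L%:R ^+ 2 by rewrite exprn_gt0 ?ltr0n.
have D1 : 8 / (9 * v ^+ 4) <= D.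
  rewrite /D ler_pdivrMr ?mulr_gt0 //.
  rewrite mulrAC ler_pdivlMr //.
  have : (L%:R ^+ 2 : R) <= 36 * N%:R by rewrite -natrX -natrM ler_nat.
  rewrite Nv; lra.
have D2 : D <= 8 / v ^+ 4.
  rewrite /D ler_pdivrMr // mulrAC ler_pdivlMr //.
  have : 4 * N%:R <= (L%:R ^+ 2 : R) by rewrite -natrX -natrM ler_nat ltnW.
  rewrite Nv; lra.
(* With T of order v, both Q / T^2 and Q D T^2 have order u^2. *)
pose T := Num.truncn v.
have /andP[T1 T2] : T%:R <= v < T.+1%:R by apply: truncn_itv; lra.
have T0 : (0 < T)%N by rewrite truncn_gt0.
have T3 : v ^+ 2 / 4 <= T%:R ^+ 2.
  have : (1 : R) <= T%:R by rewrite ler1n.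
  by move: T2; rewrite -natr1 => h1 h2; nra.
have T4 : (T%:R : R) ^+ 2 <= v ^+ 2 by rewrite lerXn2r ?nnegrE ?ler0n //; lra.
have u2 : 1 <= u ^+ 2 by rewrite exprn_ege1.
have v2 : 1 <= v ^+ 2 by rewrite exprn_ege1.
have TQ : (2 * T ^ 2 <= Q ^ 2)%N.
  rewrite -(ler_nat R) natrM !natrX expr2.
  have h2 : (2 : R) <= Q%:R by rewrite ler_nat (leq_trans _ Q16).
  rewrite ler_pM ?sqr_ge0 //; apply: le_trans T4 _; rewrite Quv; nra.
(* Dictated by [kap1]: 2 Q times 8 / (9 v^4) times v^2 / 4 equals 4/9 u^2. *)
pose kap : R := 4 / 9 * u ^+ 2.
have kap0 : 4 / 9 <= kap by rewrite /kap; lra.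
have D0 : 0 < D by rewrite divr_gt0.
have kap1 : kap <= 2 * Q%:R * D * T%:R ^+ 2.
  apply: le_trans (_ : 2 * Q%:R * (8 / (9 * v ^+ 4)) * (v ^+ 2 / 4) <= _).
    rewrite /kap Quv le_eqVlt; apply/orP; left; apply/eqP; field.
    by rewrite lt0r_neq0 //; lra.
  have QQ : 0 <= 2 * Q%:R :> R by rewrite mulr_ge0 // ltW.
  have D00 : 0 <= 8 / (9 * v ^+ 4) by rewrite divr_ge0 // mulr_ge0 // ltW.
  apply: ler_pM (mulr_ge0 QQ D00) _ (ler_wpM2l QQ D1) T3.
  by rewrite divr_ge0 ?sqr_ge0.
have kap2 : kap * T%:R ^+ 2 <= 2 * Q%:R.
  apply: le_trans (_ : kap * v ^+ 2 <= _).
    by rewrite ler_wpM2l // (le_trans _ kap0) //; lra.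
  rewrite /kap Quv; have := mulr_ge0 (sqr_ge0 u) (sqr_ge0 v).
  have key (A B : R) : 0 <= A * B -> 4 / 9 * A * B <= 2 * (A * B) by lra.
  exact: key.
pose ps : seq zi := [seq p <- GI_gbox Q | `[< GI_gprime p >] && (GI_gnorm p <= Q%:Z)].
have ups : uniq ps by exact/filter_uniq/uniq_zbox.
have hps p : p \in ps -> [/\ zprime p, (nrm p <= Q)%N & nonzero_residue_system p (res p)].
  rewrite mem_filter => /andP[/andP[pp pQ] _]; split => //.
    by rewrite -lez_nat nrm_gnorm.
  by apply: hres => //; exact/asboolP.
pose supp : seq zi := [seq n <- GI_gbox N | GI_gnorm n <= N%:Z].
have usupp : uniq supp by exact/filter_uniq/uniq_zbox.
have hsupp n : n \in supp -> exists k l : nat,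
    [/\ (k < M)%N, (l < M)%N & n = ((- M0%:Z, - M0%:Z) : zi) + (k%:Z, l%:Z)].
  rewrite mem_filter -nrm_gnorm lez_nat => /andP[nN _].
  have [n1 n2] := nrm_lt_coord (leq_ltn_trans nN M02).
  have [k [kM ek]] := shift_index n1; have [l [lM el]] := shift_index n2.
  by exists k, l; split => //; apply: zi_ext; rewrite zi_addE /=.
pose s := [seq (p, b) | p <- ps, b <- (res p : seq zi)].
pose lam := 1 + ln kap / 2.
pose Kr := 4 + F * Q%:R ^+ 2 * D * ell / lam.
have cnt w := countF Q T L kap w ps res Q16 T0 TQ L0 kap0 kap1 kap2 ups hps.
pose X1 := (1 - delta) * Lq.
have X10 : 0 < X1 by rewrite mulr_gt0 ?subr_gt0 // (lt_le_trans _ L2).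
have lnu : ln u = X1 / 4 by rewrite /u expRK.
(* ln kap / 2 is X1 / 4 + ln(4/9) / 2; the 1 in [lam] outweighs the negative constant. *)
have lam1 : X1 / 4 <= lam.
  have u0 : 0 < u by lra.
  have p49 : (0 : R) < 4 / 9 by lra.
  rewrite /lam /kap lnM ?posrE ?exprn_gt0 // lnXn // lnu mulr2n.
  have : ln ((4 / 9)^-1 : R) <= (4 / 9)^-1 - 1 by apply: ln_le_sub1; rewrite invr_gt0.
  rewrite lnV ?posrE //; set l49 := ln (4 / 9).
  have key (A Y : R) : - A <= (4 / 9)^-1 - 1 -> Y / 4 <= 1 + (A + (Y / 4 + Y / 4)) / 2 by lra.
  exact: key.
(* u^4 = exp(X1) dominates X1, and ell >= 1/2, so the 4 associates are absorbed however small 1 -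
   delta is. *)
have u4 : X1 <= u ^+ 4.
  have -> : u ^+ 4 = expR X1 by rewrite /u -expRM_natl; congr expR; rewrite /X1; field.
  by apply: le_trans (expR_ge1Dx X1); rewrite lerDr.
have Kr_le : Kr <= (8 + 32 * F) * (u ^+ 4 * ell / X1).
  have u40 : 0 <= u ^+ 4 by lra.
  have ell0 : 0 <= ell by lra.
  have a1 : 4 <= 8 * (u ^+ 4 * ell / X1).
    rewrite mulrA ler_pdivlMr //.
    have : X1 * (1 / 2) <= u ^+ 4 * ell by rewrite ler_pM //; lra.
    by lra.
  have Y0 := ltW Cs.
  have a2 : Q%:R ^+ 2 * D <= 8 * u ^+ 4.
    apply: le_trans (ler_wpM2l _ D2) _; first by rewrite sqr_ge0.
    rewrite Quv le_eqVlt; apply/orP; left; apply/eqP; field.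
    by rewrite lt0r_neq0 //; lra.
  have a3 : F * Q%:R ^+ 2 * D * ell / lam <=
      F * (8 * u ^+ 4) * ell / (X1 / 4).
    rewrite -[_ * Q%:R ^+ 2 * D]mulrA; apply: ler_pM.
    - by rewrite !mulr_ge0 // ?sqr_ge0 // ltW.
    - by rewrite invr_ge0 (le_trans _ lam1) // divr_ge0 // ltW.
    - by rewrite ler_wpM2r // ler_wpM2l.
    by rewrite lef_pV2 ?posrE ?divr_gt0 // (lt_le_trans _ lam1) // divr_gt0.
  rewrite /Kr; apply: le_trans (lerD a1 a3) _.
  rewrite le_eqVlt; apply/orP; left; apply/eqP; field.
  by rewrite lt0r_neq0.
have Kr4 : 4 <= Kr.
  rewrite lerDl divr_ge0 //; last by rewrite (le_trans _ lam1) // divr_ge0 // ltW.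
  by rewrite !mulr_ge0 ?sqr_ge0 // ?(ltW Cs) ?(ltW D0) //; lra.
pose K := Num.truncn Kr.
have K0 : (0 < K)%N by rewrite truncn_gt0; lra.
have KKr : K%:R <= Kr by rewrite truncn_le; lra.
have cntK w : (count (fun f : zi * zi => in_bin L w (cfrac R f.2 f.1)) s <= K)%N.
  by rewrite truncn_ge_nat; [exact: cnt | lra].
have := @large_sieve R _ s (fun f => cfrac R f.2 f.1) M K _ supp a (isT : (0 < M)%N) K0 usupp hsupp cntK.
have -> : \sum_(i <- s) sqn (\sum_(n <- supp) a n * chi (cfrac R i.2 i.1) n) =
  \sum_(p <- GI_gbox Q | `[< GI_gprime p >] && (GI_gnorm p <= Q%:Z))
       \sum_(b <- res p)
         GI_cabs (\sum_(n <- GI_gbox N | GI_gnorm n <= N%:Z)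
                  a n * GI_e (complex.Re (GI_gtoC R (GI_gmul n b) / GI_gtoC R p))) ^+ 2.
  rewrite /s big_allpairs_dep /ps big_filter; apply: eq_bigr => p _; apply: eq_bigr => b _.
  rewrite cabs_sq /supp big_filter; congr sqn; apply: eq_bigr => n _; congr (_ * _).
  rewrite chi_Re; congr (GI_e (complex.Re _)); rewrite /cfrac mulrA; congr (_ / _).
  by rewrite -(toCM R n b).
have -> : \sum_(n <- supp) sqn (a n) = \sum_(n <- GI_gbox N | GI_gnorm n <= N%:Z) GI_cabs (a n) ^+ 2.
  by rewrite /supp big_filter; apply: eq_bigr => n _; rewrite cabs_sq.
move=> main; apply: le_trans main _; apply: ler_wpM2r.
  by rewrite sumr_ge0 // => n _; rewrite sqr_ge0.
have MN' : (M%:R : R) ^+ 2 <= 9 / 16 * v ^+ 4.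
  apply: le_trans (_ : 9 * N%:R <= _); last by rewrite Nv; lra.
  by rewrite -natrX -natrM ler_nat.
apply: le_trans (_ : 192 ^+ 2 * ((8 + 32 * F) * (u ^+ 4 * ell / X1)) *
    (9 / 16 * v ^+ 4) <= _).
  apply: ler_pM => //; rewrite ?mulr_ge0 ?exprn_ge0 //.
  by rewrite ler_wpM2l ?exprn_ge0 // (le_trans KKr).
(* u^4 v^4 = Q^2, and X1 = (1 - delta) ln Q supplies the denominators. *)
rewrite le_eqVlt; apply/orP; left; apply/eqP; rewrite /c0 Quv /X1; field.
by rewrite !lt0r_neq0 //; lra.
Qed.
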